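(* (1) If $y_3\in\mathbb Zv$ and $y_1-y_3,\,y_2-y_3\notin\mathbb Zv$, then we have $$\lim_{\varepsilon\to0^+}\sum_\pm\pm g_4(z_1,z_2,z_3\pm i\varepsilon;\tau)=-i\,q^{-\frac32\left(\frac{y_3}{v}\right)^2}\zeta_3^{\frac{3y_3}{v}}\,\frac{\eta^3(3\tau)\,\vartheta(3(z_1+z_2);3\tau)}{\vartheta(3z_1;3\tau)\,\vartheta(3z_2;3\tau)}.$$ (2) If $y_1-y_3\in\mathbb Zv$ and $y_3,\,y_2-y_3\notin\mathbb Zv$, then we have $$\lim_{\varepsilon\to0^+}\sum_\pm\pm g_4(z_1\pm i\varepsilon,z_2,z_3)=\left(\zeta_1\zeta_3^{-1}\right)^{3\frac{y_1-y_3}{v}}q^{-\frac32\left(\frac{y_1-y_3}{v}\right)^2}f_3(z_1+z_2-z_3,\,z_2-z_3).$$ (3) If $y_2-y_3\in\mathbb Zv$ and $y_3,\,y_1-y_3\notin\mathbb Zv$, then we have $$\lim_{\varepsilon\to0^+}\sum_\pm\pm g_4(z_1,z_2\pm i\varepsilon,z_3)=\left(\zeta_2\zeta_3^{-1}\right)^{3\frac{y_2-y_3}{v}}q^{-\frac32\left(\frac{y_2-y_3}{v}\right)^2}f_3(z_1+z_2-z_3,\,z_1-z_3).$$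
   Context: Notation: $\tau=u+iv\in\mathbb H$ is fixed (and sometimes suppressed), $z_j=x_j+iy_j\in\mathbb C$, $q:=e^{2\pi i\tau}$, $\zeta_j:=e^{2\pi i z_j}$, $q^s:=e^{2\pi i s\tau}$. $\sum_\pm\pm h(\pm)$ means $h(+)-h(-)$. $\operatorname{sgn}(x):=x/|x|$ for $x\neq0$, $\operatorname{sgn}(0):=0$; $H(x):=1$ for $x>0$, $H(x):=0$ for $x\le0$; $H^*(x):=1$ for $x\ge0$, $H^*(x):=0$ for $x<0$. $\eta(\tau):=q^{1/24}\prod_{n\ge1}(1-q^n)$, $\vartheta(z;\tau):=\sum_{n\in\frac12+\mathbb Z}q^{n^2/2}e^{2\pi i n(z+\frac12)}$. Let $S_1:=\{\boldsymbol x\in\mathbb R^3:x_1,x_2\ge x_3\ge0\}$ and $S_3:=\{\boldsymbol x\in\mathbb R^3:x_1,x_2>x_3>0\}$, and, for $\boldsymbol z=\boldsymbol x+i\boldsymbol y\in\mathbb C^3$, $$g_4(\boldsymbol z;\tau):=\left(\sum_{\substack{\boldsymbol n\in\mathbb Z^3\\ \boldsymbol n+\frac{\boldsymbol y}{v}\in S_1}}+\sum_{\substack{\boldsymbol n\in\mathbb Z^3\\ \boldsymbol n+\frac{\boldsymbol y}{v}\in-S_3}}\right)q^{3n_1n_2-\frac{3n_3^2}2}\zeta_1^{3n_2}\zeta_2^{3n_1}\zeta_3^{-3n_3}.$$ For $\boldsymbol z=\boldsymbol x+i\boldsymbol y\in\mathbb C^2$ and $\chi_3(\boldsymbol x):=\operatorname{sgn}(x_1)H(|x_1|-|x_2|)H^*(x_1x_2)$,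 $$f_3(\boldsymbol z;\tau):=\sum_{\boldsymbol n\in\mathbb Z^2}\chi_3\left(\boldsymbol n+\tfrac{\boldsymbol y}{v}\right)q^{\frac32(n_1^2-n_2^2)}\zeta_1^{3n_1}\zeta_2^{-3n_2}.$$ *)

(* Defs.v *)
From mathcomp Require Import all_boot all_order all_algebra.
From mathcomp Require Import all_classical all_reals all_analysis.
From mathcomp Require Import complex finmap.
From mathcomp.analysis.showcase Require Import summability.

Set Implicit Arguments.
Unset Strict Implicit.
Unset Printing Implicit Defensive.

Import Order.TTheory GRing.Theory Num.Theory.
Import numFieldNormedType.Exports.

Local Open Scope classical_set_scope.
Local Open Scope ring_scope.
Local Open Scope complex_scope.

(* Unconditional (equivalently, absolutely convergent) sum: limit of the finite
   partial sums along the net of finite subsets of [I].  The topology on [R[i]]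
   is the one carried by the regular module [R[i]^o]. *)
Definition csum (R : realType) (I : choiceType) (f : I -> R[i]) : R[i] :=
  sum (R := (R[i])^o) f.

Definition csum_on (R : realType) (I : choiceType) (P : I -> bool)
    (f : I -> R[i]) : R[i] :=
  csum (fun n => if P n then f n else 0).

Definition cexp (R : realType) (z : R[i]) : R[i] :=
  (expR (complex.Re z))%:C * (cos (complex.Im z) +i* sin (complex.Im z)).

Definition e2pi (R : realType) (z : R[i]) : R[i] :=
  cexp (2%:R * pi%:C * 'i%C * z).

Definition qpow (R : realType) (tau : R[i]) (s : R) : R[i] := e2pi (s%:C * tau).

Definition zeta (R : realType) (z : R[i]) : R[i] := e2pi z.

Definition eta (R : realType) (tau : R[i]) : R[i] :=
  qpow tau (24%:R^-1) *
  lim ((\prod_(1 <= n < N.+1) (1 - qpow tau n%:R) : (R[i])^o) @[N --> \oo]).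

(* The half-integer index of the theta series is [m + 1/2] with [m : int]. *)
Definition theta (R : realType) (z tau : R[i]) : R[i] :=
  csum (fun m : int =>
    let n : R := m%:~R + 2%:R^-1 in
    qpow tau (n ^+ 2 / 2%:R) * e2pi (n%:C * (z + 2%:R^-1))).

Definition H (R : realType) (x : R) : R := if 0 < x then 1 else 0.

Definition Hstar (R : realType) (x : R) : R := if 0 <= x then 1 else 0.

Definition chi3 (R : realType) (x1 x2 : R) : R :=
  Num.sg x1 * H (`|x1| - `|x2|) * Hstar (x1 * x2).

Definition S1 (R : realType) (x1 x2 x3 : R) : bool :=
  [&& x3 <= x1, x3 <= x2 & 0 <= x3].

Definition S3 (R : realType) (x1 x2 x3 : R) : bool :=
  [&& x3 < x1, x3 < x2 & 0 < x3].

Definition g4_term (R : realType) (z1 z2 z3 tau : R[i]) (n : int * int * int) :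
    R[i] :=
  let: (n1, n2, n3) := n in
  qpow tau (3%:R * n1%:~R * n2%:~R - 3%:R * n3%:~R ^+ 2 / 2%:R) *
  zeta z1 ^ (3 * n2) * zeta z2 ^ (3 * n1) * zeta z3 ^ (- (3 * n3)).

Definition shift (R : realType) (v y : R) (n : int) : R := n%:~R + y / v.

Definition g4 (R : realType) (z1 z2 z3 tau : R[i]) : R[i] :=
  let v := complex.Im tau in
  let s1 := shift v (complex.Im z1) in
  let s2 := shift v (complex.Im z2) in
  let s3 := shift v (complex.Im z3) in
  csum_on (fun n : int * int * int =>
             let: (n1, n2, n3) := n in S1 (s1 n1) (s2 n2) (s3 n3))
          (g4_term z1 z2 z3 tau) +
  csum_on (fun n : int * int * int =>
             let: (n1, n2, n3) := n in S3 (- s1 n1) (- s2 n2) (- s3 n3))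
          (g4_term z1 z2 z3 tau).

Definition f3 (R : realType) (z1 z2 tau : R[i]) : R[i] :=
  let v := complex.Im tau in
  csum (fun n : int * int =>
    let: (n1, n2) := n in
    (chi3 (shift v (complex.Im z1) n1) (shift v (complex.Im z2) n2))%:C *
    qpow tau (3%:R / 2%:R * (n1%:~R ^+ 2 - n2%:~R ^+ 2)) *
    zeta z1 ^ (3 * n1) * zeta z2 ^ (- (3 * n2))).

Definition inZv (R : realType) (v y : R) : Prop := exists k : int, y = k%:~R * v.

(* Main.v *)
(** Each part is a jump of [g4] when one linear form of [y / v] crosses an
integer.  For small [eps] the two summation regions are constant, they differ
only in one slice of the lattice, and on them the terms are bounded by a
geometric sequence in [|n1| + |n2| + |n3|], so the limit is the sum over the
slice.  In parts (2) and (3) the slice [n1 = n3 - k] (resp. [n2 = n3 - k])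
becomes the series of [f3] after a linear change of indices.

In part (1), with [Q = q^3], [a = zeta1^3], [b = zeta2^3], the slice is,
up to elementary factors and a shift of [b] by a power of [Q], Kronecker's
series [F(a, b) = sum_n b^n / (1 - a Q^n)] in [|Q| < |b| < 1].  Let
[j(x) = sum_m (-1)^m Q^(m(m-1)/2) x^m].  The coefficients [c_N] of
[F(a, b) j(b)] in [b] satisfy [c_(N+1) = - a Q^N c_N], since the defect is
[- j(Q) = 0]; hence [F(a, b) j(b) = c_0 j(a b)], where
[c_0 = sum_m (-1)^m Q^(m(m+1)/2) / (1 - a Q^m)].  Finally
[c_0 j(a) = (Q; Q)^3]: when the terms of both series are weighted by
[1 / ((Q; Q)_(N-m) (Q; Q)_(N+m))], each becomes a finite sum satisfying a
first-order recurrence in [N] (the finite Jacobi triple product and its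
partial-fraction counterpart), the product of the two sums telescopes, and
one lets [N] tend to infinity. *)

Require Import Defs.
From mathcomp Require Import all_boot all_order all_algebra.
From mathcomp Require Import all_classical all_reals all_analysis.
From mathcomp Require Import complex finmap.
From mathcomp.analysis.showcase Require Import summability.
From mathcomp Require Import ring lra zify.

Set Implicit Arguments.
Unset Strict Implicit.
Unset Printing Implicit Defensive.

Import Order.TTheory GRing.Theory Num.Theory.
Import numFieldNormedType.Exports.
Import Normc.

Local Open Scope classical_set_scope.
Local Open Scope ring_scope.
Local Open Scope complex_scope.

#[local] Existing Instance totally_filter.

(** * Limits and unconditional sums of complex numbers *)
Section Limits.
Variable R : realType.
Local Notation C := R[i].

(** The exponent of [g4] is an indefinite form. On the cone [S1] it is at least [3/2 s1 s2] in the
    variables [s = n + y / v], which degenerates along the axes [s1 = 0] and [s2 = 0]. The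
    hypotheses that certain [y]'s avoid [Zv] keep [s1] and [s2] at a fixed distance [d] from [0],
    uniformly in [eps], and this distance gives the geometric majorant. The theta identity uses no
    complex analysis: it rests on rearranging dominated sums and on dominated limits in [N]. The
    weights [1 / ((Q; Q)_(N-m) (Q; Q)_(N+m))] tend to [(Q; Q)^(-2)] for each fixed [m], so the
    finite sums recover both infinite series up to that constant. The resulting identity also shows
    that [j(a)] is nonzero, which justifies the later divisions. The annulus [|Q| < |b| < 1] need
    not contain [zeta2^3]. The power of [Q] that moves it there is the same integer [c] at which the
    condition [0 <= n2 + y2 / v] begins to hold, so shifted geometric sums produce it
    automatically. *)

Definition tends (T : Type) (F : set_system T) (u : T -> C) (l : C) : Prop :=
  forall e : R, 0 < e -> \forall t \near F, normc (u t - l) < e.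

Lemma normc_ge0 (z : C) : 0 <= normc z.
Proof. by case: z => a b; rewrite /normc sqrtr_ge0. Qed.

Lemma normc_distC (x y : C) : normc (x - y) = normc (y - x).
Proof. by rewrite -normcN opprB. Qed.

Lemma normc_tri (x y z : C) : normc (x - z) <= normc (x - y) + normc (y - z).
Proof. by rewrite (le_trans _ (le_normcD _ _)) // addrA subrK. Qed.

Lemma normc_sum (I : Type) (r : seq I) (P : pred I) (f : I -> C) :
  normc (\sum_(i <- r | P i) f i) <= \sum_(i <- r | P i) normc (f i).
Proof.
elim/big_rec2: _ => [|i x y _ xy]; first by rewrite normc0.
by rewrite (le_trans (le_normcD _ _)) // lerD2l.
Qed.

Lemma normc_prod (I : Type) (r : seq I) (P : pred I) (f : I -> C) :
  normc (\prod_(i <- r | P i) f i) = \prod_(i <- r | P i) normc (f i).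
Proof. by elim/big_rec2: _ => [|i x y _ xy]; rewrite ?normc1 // normcM xy. Qed.

Lemma normcX (x : C) n : normc (x ^+ n) = normc x ^+ n.
Proof. by elim: n => [|n IH]; rewrite ?normc1 // !exprS normcM IH. Qed.

Lemma normcXz (x : C) (n : int) : normc (x ^ n) = normc x ^ n.
Proof. by case: n => n; rewrite /exprz ?normcV normcX. Qed.

Lemma normc_real (x : R) : normc x%:C = `|x|.
Proof. by rewrite /normc /= expr0n addr0 sqrtr_sqr. Qed.

(** The norm of [R[i]^o] takes values in [R[i]]. Working with the real modulus [normc] keeps every
    estimate in [R], and this equivalence is the bridge back to filter convergence. *)
Lemma tends_cvg (T : Type) (F : set_system T) {FF : Filter F} (u : T -> C) (l : C) :
  tends F u l <-> (u t : C^o) @[t --> F] --> (l : C^o).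
Proof.
split=> H.
  apply/cvgrPdist_lt => e e0.
  have er : e = (complex.Re e)%:C.
    by case: e e0 => a b; rewrite ltcE /= => /andP[/eqP -> _].
  have e0' : 0 < complex.Re e by move: e0; rewrite er ltcR.
  apply: filterS (H _ e0') => t.
  by rewrite normc_distC er /= -ltcR.
move=> e e0; move/cvgrPdist_lt: H => /(_ e%:C); rewrite ltcR => /(_ e0).
by apply: filterS => t; rewrite normc_distC -ltcR.
Qed.

Lemma tends_unique (T : Type) (F : set_system T) {FF : ProperFilter F} (u : T -> C) (l m : C) :
  tends F u l -> tends F u m -> l = m.
Proof.
move=> H K; apply/eqP; rewrite -subr_eq0; apply/eqP/eq0_normc/eqP.
rewrite eq_le normc_ge0 andbT; apply/ler_addgt0Pr => e e0; rewrite add0r.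
have e2 : 0 < e / 2 by rewrite divr_gt0.
have [t [H1 H2]] := filter_ex (filterI (H _ e2) (K _ e2)).
rewrite (le_trans (normc_tri _ (u t) _)) // [e]splitr normc_distC.
by rewrite ltW // ltrD.
Qed.

Lemma tends_cst (T : Type) (F : set_system T) {FF : Filter F} (l : C) :
  tends F (fun=> l) l.
Proof. by move=> e e0; apply: nearW => t; rewrite subrr normc0. Qed.

Lemma tendsD (T : Type) (F : set_system T) {FF : Filter F} (u w : T -> C) (l m : C) :
  tends F u l -> tends F w m -> tends F (fun t => u t + w t) (l + m).
Proof.
move=> H K e e0; have e2 : 0 < e / 2 by rewrite divr_gt0.
apply: filterS2 (H _ e2) (K _ e2) => t lt1 lt2.
rewrite opprD addrACA (le_lt_trans (le_normcD _ _)) //.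
by rewrite [e]splitr ltrD.
Qed.

Lemma tendsM (T : Type) (F : set_system T) {FF : Filter F} (u w : T -> C) (l m : C) :
  tends F u l -> tends F w m -> tends F (fun t => u t * w t) (l * m).
Proof.
move=> H K e e0; set b := normc l + normc m + 1.
have b1 : 1 <= b by rewrite lerDr addr_ge0 ?normc_ge0.
have b0 : 0 < b := lt_le_trans ltr01 b1.
have d0 : 0 < Num.min 1 (e / (2 * b)).
  by rewrite lt_min ltr01 divr_gt0 // mulr_gt0.
apply: filterS2 (H _ d0) (K _ d0) => t; rewrite !lt_min => /andP[_ lt1] /andP[lt2 lt3].
have -> : u t * w t - l * m = (u t - l) * w t + l * (w t - m) by ring.
rewrite (le_lt_trans (le_normcD _ _)) // !normcM.
have wb : normc (w t) <= b.
  rewrite -[w t](subrK m) (le_trans (le_normcD _ _)) //.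
  by have := normc_ge0 l; rewrite /b; lra.
have lb : normc l <= b by have := normc_ge0 m; rewrite /b; lra.
have e0' : e = (e / (2 * b)) * b + b * (e / (2 * b)).
  by field; rewrite gt_eqF.
rewrite [ltRHS]e0' ltr_leD //; last first.
  by rewrite ler_pM ?normc_ge0 // ltW.
apply: (@le_lt_trans _ _ (normc (u t - l) * b)).
  by rewrite ler_wpM2l ?normc_ge0.
by rewrite ltr_pM2r.
Qed.

Lemma tends_eq (T : Type) (F : set_system T) {FF : Filter F} (u w : T -> C) (l : C) :
  (\forall t \near F, u t = w t) -> tends F u l -> tends F w l.
Proof.
move=> uw ul e e0.
by apply: filterS2 uw (ul _ e0) => t ->.
Qed.

Lemma tendsZ (T : Type) (F : set_system T) {FF : Filter F} (c : C) (u : T -> C) (l : C) :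
  tends F u l -> tends F (fun t => c * u t) (c * l).
Proof. exact: tendsM (tends_cst c). Qed.

Lemma tendsB (T : Type) (F : set_system T) {FF : Filter F} (u w : T -> C) (l m : C) :
  tends F u l -> tends F w m -> tends F (fun t => u t - w t) (l - m).
Proof.
move=> H K; apply: tendsD => // e e0; apply: filterS (K _ e0) => t.
by rewrite -opprD normcN.
Qed.

Lemma tends_sum (T : Type) (F : set_system T) {FF : Filter F} (I : Type) (r : seq I)
    (u : T -> I -> C) (l : I -> C) :
  (forall i, tends F (u^~ i) (l i)) ->
  tends F (fun t => \sum_(i <- r) u t i) (\sum_(i <- r) l i).
Proof.
move=> H; elim: r => [|i r IH].
  by rewrite big_nil; apply: tends_eq (tends_cst 0); apply: nearW => t; rewrite big_nil.
rewrite big_cons; apply: tends_eq (tendsD (H i) IH).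
by apply: nearW => t; rewrite big_cons.
Qed.

Lemma tends_le (T : Type) (F : set_system T) {FF : ProperFilter F}
    (u : T -> C) (l : C) (b : R) :
  tends F u l -> (\forall t \near F, normc (u t) <= b) -> normc l <= b.
Proof.
move=> H K; apply/ler_addgt0Pr => e e0.
have [t [H1 H2]] := filter_ex (filterI (H e e0) K).
have := le_normcD (l - u t) (u t); rewrite subrK normc_distC => /le_trans; apply.
by rewrite addrC lerD // ltW.
Qed.
End Limits.

(** * Unconditional sums under a majorant: existence, Fubini, dominated convergence *)

Section Sums.
Variable R : realType.
Local Notation C := R[i].

Definition has_csum (I : choiceType) (f : I -> C) (l : C) : Prop :=
  tends (@totally I) (fun A : {fset I} => \sum_(i <- A) f i) l.

Lemma has_csumP (I : choiceType) (f : I -> C) (l : C) :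
  has_csum f l <-> forall e : R, 0 < e -> exists A : {fset I},
    forall B : {fset I}, (A `<=` B)%fset -> normc (\sum_(i <- B) f i - l) < e.
Proof.
split=> H e e0; have := H e e0.
  by move=> [A _ HA]; exists A => B AB; apply: HA.
by move=> [A HA]; exists A => // B /= AB; apply: HA.
Qed.

Lemma has_csum_unique (I : choiceType) (f : I -> C) (l m : C) :
  has_csum f l -> has_csum f m -> l = m.
Proof. exact: tends_unique. Qed.

Lemma has_csum_csum (I : choiceType) (f : I -> C) (l : C) : has_csum f l -> csum f = l.
Proof.
move=> H; rewrite /csum /sum.
have K : tends (@totally I) (partial_sum (R := C^o) f) l.
  apply: tends_eq H; apply: nearW => A.
  by rewrite /partial_sum big_seq_fsetE.
move/tends_cvg: K => K.
exact: (cvg_lim (@norm_hausdorff C C^o) K).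
Qed.

Lemma has_csum_eq (I : choiceType) (f g : I -> C) (l : C) :
  f =1 g -> has_csum f l -> has_csum g l.
Proof. by move=> /funext ->. Qed.

Lemma has_csumD (I : choiceType) (f g : I -> C) (l m : C) :
  has_csum f l -> has_csum g m -> has_csum (fun i => f i + g i) (l + m).
Proof.
move=> H K; apply: tends_eq (tendsD H K).
by apply: nearW => A; rewrite big_split.
Qed.

Lemma has_csumZ (I : choiceType) (c : C) (f : I -> C) (l : C) :
  has_csum f l -> has_csum (fun i => c * f i) (c * l).
Proof.
move=> H; apply: tends_eq (tendsZ c H).
by apply: nearW => A; rewrite mulr_sumr.
Qed.

Lemma has_csumMr (I : choiceType) (c : C) (f : I -> C) (l : C) :
  has_csum f l -> has_csum (fun i => f i * c) (l * c).
Proof.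
move=> /(has_csumZ c); rewrite mulrC; apply: has_csum_eq => i; exact: mulrC.
Qed.

Lemma has_csumB (I : choiceType) (f g : I -> C) (l m : C) :
  has_csum f l -> has_csum g m -> has_csum (fun i => f i - g i) (l - m).
Proof.
move=> H K; apply: tends_eq (tendsB H K).
by apply: nearW => A; rewrite sumrB.
Qed.

Lemma has_csum_reindex (I J : choiceType) (h : I -> J) (f : J -> C) (l : C) :
  bijective h -> has_csum f l -> has_csum (f \o h) l.
Proof.
move=> [k hk kh] /has_csumP H; apply/has_csumP => e e0.
have [A HA] := H e e0; exists (k @` A)%fset => B AB.
have -> : \sum_(i <- B) (f \o h) i = \sum_(j <- (h @` B)%fset) f j.
  by rewrite big_imfset //= => x y _ _; apply: (can_inj hk).
apply: HA; apply/fsubsetP => a aA; apply/imfsetP; exists (k a) => //=.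
by apply: (fsubsetP AB); apply/imfsetP; exists a.
Qed.

Lemma has_csum_delta (I : choiceType) (i0 : I) (f : I -> C) :
  (forall i, i != i0 -> f i = 0) -> has_csum f (f i0).
Proof.
move=> H; apply/has_csumP => e e0; exists [fset i0]%fset => B; rewrite fsub1set => iB.
rewrite (big_fsetD1 i0) //= big1_fset ?addr0 ?subrr ?normc0 // => i.
by rewrite !inE => /andP[ii0 _] _; exact: H.
Qed.

(** Summability of a nonnegative family, expressed by finite sums alone; these families serve as
    majorants throughout. *)
Definition bounded_sums (I : choiceType) (M : I -> R) : Prop :=
  (forall i, 0 <= M i) /\
  exists K, forall A : {fset I}, \sum_(i <- A) M i <= K.

Lemma ler_fsubset (I : choiceType) (M : I -> R) (A B : {fset I}) :
  (forall i, 0 <= M i) -> (A `<=` B)%fset -> \sum_(i <- A) M i <= \sum_(i <- B) M i.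
Proof.
move=> M0 AB; rewrite [leRHS](big_fsetID _ (mem A)) /=.
rewrite (_ : [fset x | x in B & x \in A]%fset = A); last first.
  by apply/fsetP => x; rewrite !inE /= andbC; apply: andb_idr => /(fsubsetP AB).
by rewrite lerDl sumr_ge0.
Qed.

(** A finite set whose sum is within [e] of the supremum leaves less than [e] for any set disjoint
    from it. *)
Lemma bounded_sums_tail (I : choiceType) (M : I -> R) : bounded_sums M -> forall e : R, 0 < e ->
  exists A : {fset I}, forall B, [disjoint A & B]%fset -> \sum_(i <- B) M i < e.
Proof.
move=> [M0 [K HK]] e e0.
pose S := [set \sum_(i <- A) M i | A in [set: {fset I}]].
have hS : has_sup S.
  split; first by exists (\sum_(i <- fset0) M i); exists fset0.
  by exists K => _ [A _ <-].
have [_ [A _ <-] HA] := sup_adherent e0 hS.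
exists A => B dAB.
have : \sum_(i <- (A `|` B)%fset) M i <= sup S.
  by apply: sup_upper_bound => //; exists (A `|` B)%fset.
rewrite (big_fsetID _ (mem A)) /=.
rewrite (_ : [fset x | x in (A `|` B) & x \in A]%fset = A); last first.
  by apply/fsetP => x; rewrite !inE /=; case: (x \in A); rewrite ?andbF.
rewrite (_ : [fset x | x in (A `|` B) & x \notin A]%fset = B); last first.
  apply/fsetP => x; rewrite !inE /=; have /fdisjointP := dAB => /(_ x).
  case: (x \in A) => //=; last by rewrite andbT.
  by move=> /(_ isT)/negPf ->.
by move: HA; lra.
Qed.

Lemma bounded_sums_cvg (I : choiceType) (M g : I -> R) : bounded_sums M ->
  (forall i, 0 <= g i <= M i) ->
  exists s : R, forall e : R, 0 < e -> exists A : {fset I},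
    forall B : {fset I}, (A `<=` B)%fset -> `|\sum_(i <- B) g i - s| < e.
Proof.
move=> [M0 [K HK]] gM.
have g0 i : 0 <= g i by have /andP[] := gM i.
pose S := [set \sum_(i <- A) g i | A in [set: {fset I}]].
have hS : has_sup S.
  split; first by exists (\sum_(i <- fset0) g i); exists fset0.
  exists K => _ [A _ <-]; apply: le_trans (HK A); apply: ler_sum => i _.
  by have /andP[] := gM i.
exists (sup S) => e e0; have [_ [A _ <-] HA] := sup_adherent e0 hS.
exists A => B AB; rewrite ler0_norm; last first.
  by rewrite subr_le0; apply: sup_upper_bound => //; exists B.
by have := ler_fsubset g0 AB; move: HA; lra.
Qed.

Lemma normc_ReIm (a b : R) : normc (a +i* b) <= `|a| + `|b|.
Proof.
rewrite /normc -(ler_pXn2r (n := 2)) ?nnegrE ?sqrtr_ge0 ?addr_ge0 //.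
rewrite sqr_sqrtr ?addr_ge0 ?sqr_ge0 // -(real_normK (num_real a)) -(real_normK (num_real b)).
by have := normr_ge0 a; have := normr_ge0 b; nra.
Qed.

Lemma ler_Re_normc (z : C) : `|complex.Re z| <= normc z.
Proof. by rewrite -lecR; apply: normc_ge_Re. Qed.

Lemma ler_Im_normc (z : C) : `|complex.Im z| <= normc z.
Proof.
case: z => a b; rewrite /normc /= -sqrtr_sqr ler_sqrt ?lerDr ?sqr_ge0 //.
by rewrite addr_ge0 ?sqr_ge0.
Qed.

Lemma has_csum_ex (I : choiceType) (M : I -> R) (f : I -> C) : bounded_sums M ->
  (forall i, normc (f i) <= M i) -> exists l, has_csum f l.
Proof.
move=> FM fM; have [M0 [K HK]] := FM.
have FM2 : bounded_sums (fun i => 2 * M i).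
  split=> [i|]; first by rewrite mulr_ge0.
  by exists (2 * K) => A; rewrite -mulr_sumr ler_wpM2l.
have dom (g : I -> R) : (forall i, `|g i| <= M i) ->
    exists s : R, forall e : R, 0 < e -> exists A : {fset I},
    forall B : {fset I}, (A `<=` B)%fset -> `|\sum_(i <- B) g i - s| < e.
  move=> gM.
  (* Adding [M] makes a signed family nonnegative with majorant [2 M]; the limit of [M] itself is
     subtracted afterwards. *)
  have [i|s1 H1] := @bounded_sums_cvg _ _ (fun i => g i + M i) FM2.
    by have := gM i; rewrite ler_norml; lra.
  have [i|s2 H2] := @bounded_sums_cvg _ _ M FM; first by rewrite M0 lexx.
  exists (s1 - s2) => e e0; have e2 : 0 < e / 2 by rewrite divr_gt0.
  have [A1 HA1] := H1 _ e2; have [A2 HA2] := H2 _ e2.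
  exists (A1 `|` A2)%fset => B; rewrite fsubUset => /andP[/HA1 + /HA2].
  by rewrite big_split /= !ltr_norml; lra.
have [i|a Ha] := dom (fun i => complex.Re (f i)); first exact: le_trans (ler_Re_normc _) _.
have [i|b Hb] := dom (fun i => complex.Im (f i)); first exact: le_trans (ler_Im_normc _) _.
exists (a +i* b); apply/has_csumP => e e0; have e2 : 0 < e / 2 by rewrite divr_gt0.
have [A1 HA1] := Ha _ e2; have [A2 HA2] := Hb _ e2.
exists (A1 `|` A2)%fset => B; rewrite fsubUset => /andP[/HA1 h1 /HA2 h2].
rewrite [X in normc X](_ : _ = (\sum_(i <- B) complex.Re (f i) - a) +i*
   (\sum_(i <- B) complex.Im (f i) - b)).
  by rewrite (le_lt_trans (normc_ReIm _ _)) // [e]splitr ltrD.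
have -> : \sum_(i <- B) f i =
    (\sum_(i <- B) complex.Re (f i)) +i* (\sum_(i <- B) complex.Im (f i)).
  elim/big_rec3: _ => // i x y z _ ->; by case: (f i).
by [].
Qed.

(** [csum] is a [lim] and has a default value in case of divergence; a majorant certifies that it is
    a genuine sum. *)
Lemma csumP (I : choiceType) (M : I -> R) (f : I -> C) : bounded_sums M ->
  (forall i, normc (f i) <= M i) -> has_csum f (csum f).
Proof.
by move=> FM fM; have [l Hl] := has_csum_ex FM fM; rewrite (has_csum_csum Hl).
Qed.

Lemma has_csum_tail (I : choiceType) (M : I -> R) (f : I -> C) (l : C) (e : R)
    (A : {fset I}) : (forall i, normc (f i) <= M i) -> has_csum f l ->
  0 < e -> (forall B, [disjoint A & B]%fset -> \sum_(i <- B) M i < e) ->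
  normc (\sum_(i <- A) f i - l) < e + e.
Proof.
move=> fM /has_csumP Hf e0 HA; have [A1 HA1] := Hf _ e0.
rewrite (le_lt_trans (normc_tri _ (\sum_(i <- (A `|` A1)%fset) f i) _)) //.
rewrite ltrD ?HA1 ?fsubsetUr //.
rewrite [X in _ - X](big_fsetID _ (mem A)) /=.
rewrite (_ : [fset x | x in (A `|` A1) & x \in A]%fset = A); last first.
  by apply/fsetP => x; rewrite !inE /=; case: (x \in A); rewrite ?andbF.
rewrite opprD addrA subrr add0r normcN (le_lt_trans (normc_sum _ _ _)) //.
apply: le_lt_trans (HA [fset x | x in (A `|` A1) & x \notin A]%fset _).
  exact: ler_sum.
by apply/fdisjointP => x xA; rewrite !inE /= xA andbF.
Qed.

(** Tannery's theorem along a proper filter: one finite set [A] controls the tails for all [t] at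
    once, and termwise limits suffice on [A]. *)
Lemma tends_csum (T : Type) (F : set_system T) {FF : ProperFilter F}
    (I : choiceType) (M : I -> R) (f : T -> I -> C) (g : I -> C) :
  bounded_sums M -> (\forall t \near F, forall i, normc (f t i) <= M i) ->
  (forall i, tends F (f^~ i) (g i)) ->
  tends F (fun t => csum (f t)) (csum g).
Proof.
move=> FM fM fg.
have gM i : normc (g i) <= M i.
  by apply: (tends_le (fg i)); apply: filterS fM => t.
(* Five shares: [has_csum_tail] costs two for [f t] and two for [g], and the finite sum over [A]
   costs one. *)
move=> e e0; have e5 : 0 < e / 5 by rewrite divr_gt0.
have [A HA] := bounded_sums_tail FM e5.
have Hg := has_csum_tail gM (csumP FM gM) e5 HA.
apply: filterS2 fM (tends_sum (enum_fset A) fg e5) => t ftM H.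
have Hf := has_csum_tail ftM (csumP FM ftM) e5 HA.
rewrite (le_lt_trans (normc_tri _ (\sum_(i <- A) f t i) _)) //.
rewrite normc_distC.
have := normc_tri (\sum_(i <- A) f t i) (\sum_(i <- A) g i) (csum g).
by move: H Hf Hg; lra.
Qed.

Lemma big_fsetM (V : nmodType) (I J : choiceType) (A : {fset I}) (B : {fset J})
    (f : I * J -> V) :
  \sum_(p <- (A `*` B)%fset) f p = \sum_(i <- A) \sum_(j <- B) f (i, j).
Proof.
rewrite (perm_big [seq (i, j) | i <- A, j <- B]) ?big_allpairs //.
apply: uniq_perm.
- exact: fset_uniq.
- by rewrite allpairs_uniq ?fset_uniq // => -[? ?] [? ?].
move=> [i j]; rewrite in_fsetM.
apply/andP/allpairsP => [[/= iA jB]|[[a b] [/= aA bB [-> ->]]]] //.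
by exists (i, j).
Qed.

(** For fixed [B], the finite sum of row sums is a limit of sums over rectangles [B * D]. Once [B]
    and [D] contain the projections of [A], each rectangle contains [A], so its sum is already
    within [e / 2] of [l]. *)
Lemma has_csum_Fubini (I J : choiceType) (f : I * J -> C) (g : I -> C) (l : C) :
  has_csum f l -> (forall i, has_csum (fun j => f (i, j)) (g i)) -> has_csum g l.
Proof.
move=> /has_csumP Hf Hg; apply/has_csumP => e e0.
have e2 : 0 < e / 2 by rewrite divr_gt0.
have [A HA] := Hf _ e2.
exists (fst @` A)%fset => B AB.
have T : tends (@totally J) (fun D : {fset J} => \sum_(i <- B) \sum_(j <- D) f (i, j))
    (\sum_(i <- B) g i).
  exact: tends_sum.
apply: (@le_lt_trans _ _ (e / 2)); last by rewrite ltr_pdivrMr // ltr_pMr // ltr1n.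
apply: tends_le (tendsB T (tends_cst l)) _.
exists (snd @` A)%fset => // D /= AD.
have -> : \sum_(i <- B) \sum_(j <- D) f (i, j) = \sum_(p <- (B `*` D)%fset) f p.
  exact/esym/big_fsetM.
apply/ltW/HA; apply/fsubsetP => -[i j] ijA; rewrite in_fsetM /=.
rewrite (fsubsetP AB) ?(fsubsetP AD) //.
  by apply/imfsetP; exists (i, j).
by apply/imfsetP; exists (i, j).
Qed.

Lemma sum_fsetM (I J : choiceType) (M : I -> R) (N : J -> R) (A : {fset I * J}) :
  (forall i, 0 <= M i) -> (forall j, 0 <= N j) ->
  \sum_(p <- A) M p.1 * N p.2 <=
  (\sum_(i <- (fst @` A)%fset) M i) * (\sum_(j <- (snd @` A)%fset) N j).
Proof.
move=> M0 N0.
apply: (@le_trans _ _ (\sum_(p <- ((fst @` A) `*` (snd @` A))%fset) M p.1 * N p.2)).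
  apply: (@ler_fsubset _ (fun p => M p.1 * N p.2)) => [p|]; first exact: mulr_ge0.
  apply/fsubsetP => -[i j] ijA; rewrite in_fsetM /=.
  by apply/andP; split; apply/imfsetP; exists (i, j).
rewrite mulr_suml (big_fsetM _ _ (fun p => M p.1 * N p.2)).
by apply: ler_sum => i _; rewrite mulr_sumr.
Qed.

Lemma bounded_sumsM (I J : choiceType) (M : I -> R) (N : J -> R) :
  bounded_sums M -> bounded_sums N -> bounded_sums (fun p : I * J => M p.1 * N p.2).
Proof.
move=> [M0 [K HK]] [N0 [L HL]]; split=> [p|]; first exact: mulr_ge0.
exists (K * L) => A; apply: le_trans (sum_fsetM _ M0 N0) _.
by rewrite ler_pM ?sumr_ge0.
Qed.

Lemma bounded_sumsZ (I : choiceType) (M : I -> R) (c : R) :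
  0 <= c -> bounded_sums M -> bounded_sums (fun i => c * M i).
Proof.
move=> c0 [M0 [K HK]]; split=> [i|]; first exact: mulr_ge0.
by exists (c * K) => A; rewrite -mulr_sumr ler_wpM2l.
Qed.

Lemma bounded_sums_inj (I J : choiceType) (h : I -> J) (M : J -> R) :
  injective h -> bounded_sums M -> bounded_sums (M \o h).
Proof.
move=> hi [M0 [K HK]]; split=> [i|]; first exact: M0.
exists K => A; apply: le_trans (HK (h @` A)%fset).
by rewrite big_imfset //= => x y _ _; apply: hi.
Qed.

Lemma bounded_sums_geo_nat (r : R) : 0 <= r < 1 -> bounded_sums (fun n : nat => r ^+ n).
Proof.
move=> /andP[r0 r1]; split=> [n|]; first exact: exprn_ge0.
exists (1 - r)^-1 => A.
have [N AN] : exists N : nat, forall x, x \in A -> (x < N)%N.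
  exists (\max_(i <- A) i).+1 => x xA.
  by rewrite ltnS (@leq_bigmax_seq _ _ _ id x).
apply: (@le_trans _ _ (\sum_(i < N) r ^+ i)).
  rewrite -(big_mkord xpredT (fun i => r ^+ i)).
  pose B := [fset i in iota 0 N]%fset.
  have -> : \sum_(0 <= i < N) r ^+ i = \sum_(i <- B) r ^+ i.
    apply: perm_big; apply: uniq_perm; [exact: iota_uniq | exact: fset_uniq |].
    by move=> x; rewrite mem_index_iota in_fset /= mem_iota.
  apply: (@ler_fsubset _ (fun i => r ^+ i)) => [i|]; first exact: exprn_ge0.
  apply/fsubsetP => x xA; rewrite in_fset /=.
  by rewrite mem_iota /= add0n AN.
rewrite -[leRHS]mul1r ler_pdivlMr ?subr_gt0 // mulrC.
rewrite -[X in X * _]opprB mulNr -subrX1 opprB lerBlDr lerDl.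
exact: exprn_ge0.
Qed.

Lemma bounded_sums_bool : bounded_sums (fun b : bool => 1 : R).
Proof.
split=> //; exists (\sum_(b <- [fset true; false]%fset) 1) => A.
by apply: (@ler_fsubset _ (fun=> 1)) => //; apply/fsubsetP => -[]; rewrite !inE.
Qed.

Lemma bounded_sums_geo (r : R) : 0 <= r < 1 -> bounded_sums (fun n : int => r ^+ `|n|%N).
Proof.
move=> r01; have H := bounded_sumsM bounded_sums_bool (bounded_sums_geo_nat r01).
(* The sign and the absolute value embed [int] into [bool * nat], where the product of two majorants
   is available. *)
have hi : injective (fun n : int => (n < 0, `|n|%N)) by move=> m n [] ; lia.
have := bounded_sums_inj hi H; congr bounded_sums; apply/funext => n /=.
by rewrite mul1r.
Qed.

Lemma bounded_sums_slice (I J : choiceType) (M : I * J -> R) (i : I) :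
  bounded_sums M -> bounded_sums (fun j => M (i, j)).
Proof. by apply: (@bounded_sums_inj _ _ (fun j => (i, j))) => x y []. Qed.

Lemma csum_Fubini (I J : choiceType) (M : I * J -> R) (f : I * J -> C) :
  bounded_sums M -> (forall p, normc (f p) <= M p) ->
  has_csum (fun i => csum (fun j => f (i, j))) (csum f).
Proof.
move=> FM fM; apply: has_csum_Fubini (csumP FM fM) _ => i.
by apply: csumP (bounded_sums_slice i FM) _ => j.
Qed.

End Sums.

(** * q-Pochhammer symbols and theta coefficients *)
Section IntTools.

(** Suited to recurrences whose step multiplies both sides by a nonzero factor: such a step can be
    read in both directions. *)
Lemma int_ind_iff (P : int -> Prop) :
  P 0 -> (forall n, P n <-> P (n + 1)) -> forall n, P n.
Proof.
move=> P0 PS; elim/int_rect => [//|n IH|n IH].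
  by rewrite intS addrC; apply: (PS _).1.
by apply: (PS _).2; rewrite (_ : - n.+1%:Z + 1 = - n%:Z) //; lia.
Qed.

Definition tri (m : int) : int := ((m * (m - 1)) %/ 2)%Z.

Lemma triE m : 2 * tri m = m * (m - 1).
Proof.
rewrite /tri mulrC divzK //; move: m; apply: int_ind_iff => [|n].
  by rewrite mul0r.
rewrite (_ : (n + 1) * (n + 1 - 1) = n * (n - 1) + n * 2); last by ring.
by rewrite rpredDr // dvdz_mull.
Qed.

Lemma triS m : tri (m + 1) = tri m + m.
Proof. by apply: (mulfI (x := 2%:Z)) => //; rewrite mulrDr !triE; ring. Qed.

Lemma triC m : tri (1 - m) = tri m.
Proof. by apply: (mulfI (x := 2%:Z)) => //; rewrite !triE; ring. Qed.

Lemma tri0 : tri 0 = 0.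
Proof. by apply: (mulfI (x := 2%:Z)) => //; rewrite !triE; ring. Qed.

(** Quadratic growth beats any linear rate. With [n = |m|] it suffices that
    [n^2 / 2 - (A + 3/2) n + (A + 2)^2] be nonnegative, and its discriminant is negative. *)
Lemma tri_lower (A : nat) (m : int) :
  (`|m|%N%:Z <= tri m - A%:Z * `|m|%N%:Z + (A%:Z + 2) ^+ 2).
Proof.
rewrite -(ler_pM2l (x := 2%:Z)) // !mulrDr triE mulrN abszE.
have [m0|m0] := leP 0 m; first by rewrite ger0_norm //; nia.
by rewrite ltr0_norm //; nia.
Qed.
End IntTools.

Section QSeries.
Variable R : realType.
Local Notation C := R[i].

Lemma normc_eq0 (z : C) : (normc z == 0) = (z == 0).
Proof. by apply/eqP/eqP => [/eq0_normc|->]; rewrite ?normc0. Qed.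

Lemma normc_gt0 (z : C) : (0 < normc z) = (z != 0).
Proof. by rewrite lt_neqAle normc_ge0 andbT eq_sym normc_eq0. Qed.

Lemma exprz_antimono (r : R) (a b : int) : 0 < r < 1 -> b <= a -> r ^ a <= r ^ b.
Proof.
move=> /andP[r0 r1] ba; have -> : a = b + `|a - b|%N%:Z by lia.
rewrite expfzDr ?gt_eqF // -exprnP ler_piMr ?exprz_ge0 ?(ltW r0) //.
by rewrite exprn_ile1 // ltW.
Qed.

Lemma exprn_small (r y : R) : 0 <= r < 1 -> 0 < y ->
  exists N, forall n, (N <= n)%N -> r ^+ n <= y.
Proof.
move=> /andP[r0 r1] y0.
have : (r ^+ n @[n --> \oo] --> (0 : R)) by apply: cvg_expr; rewrite ger0_norm.
move/cvgrPdist_le => /(_ y y0) [N _ HN]; exists N => n Nn.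
by have := HN n Nn; rewrite sub0r normrN ger0_norm // exprn_ge0.
Qed.

(** Choosing [A] with [r^A] below both [x] and [1 / x] gives [x^m <= r^(-A |m|)], and [tri_lower]
    absorbs this linear loss. *)
Lemma exprz_dominate (r x : R) : 0 < r < 1 -> 0 < x ->
  exists K, forall m : int, r ^ tri m * x ^ m <= K * r ^+ `|m|%N.
Proof.
move=> /andP[r0 r1] x0.
have rn0 : r != 0 by rewrite gt_eqF.
have r01 : 0 <= r < 1 by rewrite (ltW r0).
have small (y : R) : 0 < y -> exists n, r ^+ n <= y.
  by move=> /(exprn_small r01)[n Hn]; exists n; apply: Hn.
have [n1 H1] := small x x0.
have [n2 H2] := small x^-1 ltac:(by rewrite invr_gt0).
pose A := (n1 + n2)%N.
have le_exp m n : (m <= n)%N -> r ^+ n <= r ^+ m.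
  by move=> mn; rewrite ler_wiXn2l // ltW.
have xA : x <= r ^ (- A%:Z) /\ x^-1 <= r ^ (- A%:Z).
  rewrite -exprnN; split.
    rewrite -[leLHS]invrK lef_pV2 ?posrE ?invr_gt0 ?exprn_gt0 //.
    by apply: le_trans H2; apply: le_exp; rewrite leq_addl.
  rewrite lef_pV2 ?posrE ?exprn_gt0 //.
  by apply: le_trans H1; apply: le_exp; rewrite leq_addr.
have xm m : x ^ m <= r ^ (- (A%:Z * `|m|%N%:Z)).
  rewrite -mulNr -exprz_exp; case: m => n.
    by rewrite /= -!exprnP lerXn2r ?nnegrE ?(ltW x0) ?xA.1 // exprz_ge0 // ltW.
  rewrite NegzE abszN absz_nat -exprz_inv -!exprnP.
  by rewrite lerXn2r ?nnegrE ?invr_ge0 ?(ltW x0) ?xA.2 // exprz_ge0 // ltW.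
exists (r ^ (- (A%:Z + 2) ^+ 2)) => m.
apply: (@le_trans _ _ (r ^ tri m * r ^ (- (A%:Z * `|m|%N%:Z)))).
  by rewrite ler_wpM2l // exprz_ge0 // ltW.
rewrite -expfzDr // [r ^+ _]exprnP -expfzDr //.
apply: exprz_antimono; first by rewrite r0.
by have := tri_lower A m; lia.
Qed.

Section Qfix.
Variable Q : C.
Hypothesis Q0 : Q != 0.
Hypothesis Q1 : normc Q < 1.
Local Notation r := (normc Q).

Lemma nome_gt0 : 0 < r. Proof. by rewrite normc_gt0. Qed.
Hint Resolve nome_gt0 Q0 : core.

Lemma normc_Qexp_lt1 n : (0 < n)%N -> normc (Q ^+ n) < 1.
Proof. by move=> n0; rewrite normcX exprn_ilt1 ?normc_ge0 // -lt0n. Qed.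

Lemma oneBQ_neq0 n : (0 < n)%N -> 1 - Q ^+ n != 0.
Proof.
move=> n0; rewrite subr_eq0; apply/eqP => E.
by have := normc_Qexp_lt1 n0; rewrite -E normc1 ltxx.
Qed.

Definition qpoch (n : nat) : C := \prod_(1 <= k < n.+1) (1 - Q ^+ k).

Lemma qpoch0 : qpoch 0 = 1. Proof. by rewrite /qpoch big_nil. Qed.

Lemma qpochS n : qpoch n.+1 = qpoch n * (1 - Q ^+ n.+1).
Proof. by rewrite /qpoch big_nat_recr. Qed.

Lemma qpoch_neq0 n : qpoch n != 0.
Proof.
elim: n => [|n IH]; first by rewrite qpoch0 oner_neq0.
by rewrite qpochS mulf_neq0 ?oneBQ_neq0.
Qed.

(* [1 / (Q; Q)_n], extended by [0] to [n < 0] so that [iq_rec] holds on all of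
   [int]; sums weighted by [iq2] are then finite without explicit bounds. *)
Definition iq (n : int) : C := if n is Posz k then (qpoch k)^-1 else 0.

Lemma iq_rec n : iq n = (1 - Q ^ (n + 1)) * iq (n + 1).
Proof.
case: n => [n|[|n]]; first 2 last.
- by rewrite (_ : Negz n.+1 + 1 = Negz n) ?mulr0 // !NegzE; lia.
- rewrite -PoszD addn1 /= qpochS invfM mulrCA -exprnP divff ?mulr1 //.
  exact: oneBQ_neq0.
(* The case [n = -1]: the factor [1 - Q ^ 0] vanishes and kills [iq 0 = 1]. *)
- by rewrite /= subrr mul0r.
Qed.

Definition iq2 (N : nat) (m : int) : C := iq (N%:Z - m) * iq (N%:Z + m).

Definition tcoef (m : int) : C := (-1) ^ m * Q ^ tri m.

Lemma tcoefS m : tcoef (m + 1) = - Q ^ m * tcoef m.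
Proof. by rewrite /tcoef triS !expfzDr ?oppr_eq0 ?oner_neq0 // expr1z; ring. Qed.

(** [tri] is symmetric under [m -> 1 - m] while the parity of [m] flips; this antisymmetry makes
    [jtheta] vanish at [1]. *)
Lemma tcoef1B m : tcoef (1 - m) = - tcoef m.
Proof.
rewrite /tcoef triC expfzDr ?oppr_eq0 ?oner_neq0 // expr1z.
by rewrite -exprz_inv invrN invr1; ring.
Qed.

Lemma tcoefN m : tcoef (- m) = Q ^ m * tcoef m.
Proof.
have -> : - m = 1 - (m + 1) by ring.
by rewrite tcoef1B tcoefS; ring.
Qed.

Lemma tcoef0 : tcoef 0 = 1. Proof. by rewrite /tcoef tri0 !expr0z mulr1. Qed.

Lemma normc_tcoef m : normc (tcoef m) = r ^ tri m.
Proof. by rewrite /tcoef normcM !normcXz normcN normc1 exp1rz mul1r. Qed.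

(** Writing the weight of level [N] through that of level [N + 1] at the same [m] lets the
    recurrences in [N] be checked term by term as rational identities in [Q ^ m]. *)
Lemma iq2_center N m : iq2 N m =
  iq2 N.+1 m * ((1 - Q ^+ N.+1 / Q ^ m) * (1 - Q ^+ N.+1 * Q ^ m)).
Proof.
rewrite /iq2 iq_rec (iq_rec (N%:Z + m)).
have -> : N%:Z - m + 1 = N.+1%:Z - m by lia.
have -> : N%:Z + m + 1 = N.+1%:Z + m by lia.
by rewrite !expfzDr // -invr_expz -!exprnP; ring.
Qed.
End Qfix.
End QSeries.

(** * Convergence of [(Q; Q)_n] and uniform bounds on its inverses *)

Section QConv.
Variable R : realType.
Local Notation C := R[i].

Lemma has_csum_nat (f : nat -> C) (l : C) :
  has_csum f l -> tends \oo (fun n => \sum_(k < n) f k) l.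
Proof.
move=> /has_csumP H e /H[A HA].
have [N AN] : exists N : nat, forall x, x \in A -> (x < N)%N.
  exists (\max_(i <- A) i).+1 => x xA.
  by rewrite ltnS (@leq_bigmax_seq _ _ _ id x).
exists N => // n /= Nn.
pose B := [fset i in iota 0 n]%fset.
have -> : \sum_(k < n) f k = \sum_(i <- B) f i.
  rewrite -(big_mkord xpredT f).
  apply: perm_big; apply: uniq_perm; [exact: iota_uniq | exact: fset_uniq |].
  by move=> x; rewrite mem_index_iota in_fset /= mem_iota.
apply: HA; apply/fsubsetP => x xA; rewrite in_fset /= mem_iota /= add0n.
exact: leq_trans (AN x xA) Nn.
Qed.

Section Qfix.
Variable Q : C.
Hypothesis Q0 : Q != 0.
Hypothesis Q1 : normc Q < 1.
Local Notation r := (normc Q).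

Let r_gt0 : 0 < r := nome_gt0 Q0.

Lemma sum_geo_le n : (1 - r) * \sum_(1 <= k < n.+1) r ^+ k <= 1.
Proof.
suff -> : (1 - r) * \sum_(1 <= k < n.+1) r ^+ k = r - r ^+ n.+1.
  have rn0 : 0 <= r ^+ n.+1 by rewrite exprn_ge0 // ltW.
  by have := Q1; lra.
elim: n => [|n IH]; first by rewrite big_nil mulr0 expr1 subrr.
by rewrite big_nat_recr //= mulrDr IH [r ^+ n.+2]exprS; ring.
Qed.

(** Products are compared with the exponential of a geometric series; this serves both the factors
    [1 - Q^k] and their inverses. *)
Lemma prod_expR_le (x : nat -> R) (c : R) n : 0 <= c ->
  (forall k, (0 < k)%N -> 0 <= x k <= expR (c * r ^+ k)) ->
  \prod_(1 <= k < n.+1) x k <= expR (c / (1 - r)).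
Proof.
move=> c0 H.
apply: (@le_trans _ _ (expR (c * \sum_(1 <= k < n.+1) r ^+ k))).
  rewrite mulr_sumr expR_sum !big_nat.
  by apply: ler_prod => k /andP[k0 _]; exact: H.
rewrite ler_expR ler_wpM2l // -[(1 - r)^-1]mulr1 ler_pdivlMl ?subr_gt0 //.
exact: sum_geo_le.
Qed.

Lemma qpoch_ub : exists B, forall n, normc (qpoch Q n) <= B.
Proof.
exists (expR (1 / (1 - r))) => n; rewrite /qpoch normc_prod.
apply: prod_expR_le => // k k0; rewrite normc_ge0 mul1r.
apply: le_trans (expR_ge1Dx _); rewrite (le_trans (le_normcD _ _)) //.
by rewrite normcN normc1 normcX.
Qed.

Lemma iq_ub : exists B, 0 < B /\ forall n, normc (iq Q n) <= B.
Proof.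
exists (expR ((1 - r)^-1 / (1 - r))); rewrite expR_gt0; split=> // -[n|n]; last first.
  by rewrite (_ : iq Q (Negz n) = 0) // normc0 expR_ge0.
rewrite (_ : iq Q n = (qpoch Q n)^-1) // normcV /qpoch normc_prod.
have r1 : 0 < 1 - r by rewrite subr_gt0.
rewrite -prodfV; apply: prod_expR_le; first by rewrite invr_ge0 ltW.
move=> k k0; rewrite invr_ge0 normc_ge0 /=.
have rk0 : 0 <= r ^+ k by rewrite exprn_ge0 // ltW.
have rkr : r ^+ k <= r by case: k k0 {rk0} => // k _; rewrite exprS ler_piMr ?exprn_ile1 // ltW.
have H1 : 1 - r ^+ k <= normc (1 - Q ^+ k).
  have := le_normcD (1 - Q ^+ k) (Q ^+ k); rewrite subrK normc1 normcX; lra.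
have H2 : 0 < 1 - r ^+ k by lra.
apply: (@le_trans _ _ (1 - r ^+ k)^-1).
  by rewrite lef_pV2 ?posrE // (lt_le_trans H2).
rewrite -[X in X <= _]mul1r ler_pdivrMr //.
(* This is [1 / (1 - r^k) <= 1 + r^k / (1 - r)], valid for [k >= 1] since the difference after
   clearing denominators is [r^k (r - r^k) / (1 - r)]. *)
apply: (@le_trans _ _ ((1 + (1 - r)^-1 * r ^+ k) * (1 - r ^+ k))); last first.
  by rewrite ler_wpM2r ?(ltW H2) // expR_ge1Dx.
rewrite -subr_ge0.
rewrite (_ : _ - 1 = r ^+ k * (r - r ^+ k) / (1 - r)); last by field; rewrite gt_eqF.
by rewrite divr_ge0 ?(ltW r1) // mulr_ge0 // subr_ge0.
Qed.

(** Consecutive differences are [- Q^(k+1) (Q; Q)_k], dominated by a geometric sequence, so the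
    sequence converges; the uniform bound on the inverses keeps the limit away from [0]. *)
Lemma qpoch_cvg : exists P, [/\ P != 0, tends \oo (qpoch Q) P &
  forall m : int, tends \oo (fun N : nat => iq Q (N%:Z + m)) P^-1].
Proof.
have [B HB] := qpoch_ub; have [D [D0 HD]] := iq_ub.
have HD' n : normc (qpoch Q n)^-1 <= D := HD (Posz n).
have r01 : 0 <= r < 1 by rewrite (ltW r_gt0) Q1.
have B0 : 0 <= B := le_trans (normc_ge0 _) (HB 0%N).
pose d k := - (Q ^+ k.+1) * qpoch Q k.
have Md k : normc (d k) <= B * r ^+ k.
  rewrite /d normcM normcN normcX mulrC ler_pM ?normc_ge0 ?exprn_ge0 ?(ltW r_gt0) //.
  by rewrite exprS ler_piMl ?exprn_ge0 ?ltW.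
have FM := bounded_sumsZ B0 (bounded_sums_geo_nat r01).
have [S HS] := has_csum_ex FM Md.
have T : tends \oo (qpoch Q) (1 + S).
  apply: tends_eq (tendsD (tends_cst 1) (has_csum_nat HS)); apply: nearW.
  elim=> [|n IH]; first by rewrite big_ord0 addr0 qpoch0.
  by rewrite big_ord_recr /= addrA IH qpochS /d; ring.
have lb n : D^-1 <= normc (qpoch Q n).
  by rewrite -[leRHS]invrK lef_pV2 ?posrE ?invr_gt0 ?normc_gt0 ?qpoch_neq0 // -normcV.
have P0 : 1 + S != 0.
  apply/eqP => PE; have e0 : 0 < D^-1 by rewrite invr_gt0.
  have [n _ /(_ n (leqnn n))] := T _ e0.
  by rewrite /= PE subr0 ltNge lb.
exists (1 + S); split=> //.
move=> m e e0; set P := 1 + S in T P0 *.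
have e1 : 0 < e * normc P / D by rewrite !(mulr_gt0, invr_gt0, normc_gt0).
have [n0 _ Hn] := T _ e1; exists (n0 + `|m|)%N => // N /= HN.
pose n := absz (N%:Z + m); have -> : N%:Z + m = n by rewrite /n; lia.
have nn0 : (n0 <= n)%N by rewrite /n; lia.
have := Hn n nn0; rewrite /=.
have -> : (qpoch Q n)^-1 - P^-1 = - ((qpoch Q n - P) * ((qpoch Q n)^-1 / P)).
  by field; rewrite P0 qpoch_neq0.
rewrite normcN !normcM => H.
apply: (@lt_le_trans _ _ (e * normc P / D * (normc (qpoch Q n)^-1 * normc P^-1))).
  by rewrite ltr_pM2r // mulr_gt0 // normc_gt0 ?invr_neq0 ?qpoch_neq0.
rewrite [normc P^-1]normcV.
rewrite (_ : _ * _ = e * (normc (qpoch Q n)^-1 / D)).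
  by rewrite ler_piMr ?(ltW e0) // ler_pdivrMr // mul1r.
by field; rewrite normc_eq0 P0 gt_eqF.
Qed.
End Qfix.
End QConv.

(** * Theta series and the Appell sum *)
Section Theta.
Variable R : realType.
Local Notation C := R[i].

Definition jtheta (Q a : C) : C := csum (fun m : int => tcoef Q m * a ^ m).

Definition appell (Q a : C) : C :=
  csum (fun m : int => tcoef Q m * Q ^ m / (1 - a * Q ^ m)).

(** Excludes [0] and the powers of [Q], which are the poles in [a] of [appell] and [kron]. *)
Definition regular (Q a : C) : Prop := a != 0 /\ forall m : int, 1 - a * Q ^ m != 0.

Section Qfix.
Variable Q : C.
Hypothesis Q0 : Q != 0.
Hypothesis Q1 : normc Q < 1.
Local Notation r := (normc Q).

Let r_gt0 : 0 < r := nome_gt0 Q0.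
Let r01 : 0 <= r < 1. Proof. by rewrite (ltW r_gt0) Q1. Qed.
Let r01' : 0 < r < 1. Proof. by rewrite r_gt0 Q1. Qed.

Lemma regularV a : regular Q a -> regular Q a^-1.
Proof.
move=> [a0 H]; split=> [|m]; first by rewrite invr_eq0.
apply: contra (H (- m)); rewrite !subr_eq0 => /eqP E.
rewrite -invr_expz -[X in X == _](mulfV a0) (inj_eq (mulfI a0)).
suff -> : a = Q ^ m by [].
by rewrite -[a]mulr1 [X in _ * X]E mulrA mulfV // mul1r.
Qed.

Lemma int_bounded (f : int -> R) (L : R) (N : nat) :
  (forall m, 0 <= f m) -> (forall m, (N <= `|m|)%N -> f m <= L) ->
  exists2 L', 0 < L' & forall m, f m <= L'.
Proof.
move=> f0 H.
have S0 : 0 <= \sum_(k < N) (f k%:Z + f (- k%:Z)).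
  by apply: sumr_ge0 => k _; rewrite addr_ge0.
exists (`|L| + 1 + \sum_(k < N) (f k%:Z + f (- k%:Z))) => [|m].
  by have := normr_ge0 L; lra.
have [/H h|mN] := leqP N `|m|%N.
  by have := ler_norm L; lra.
rewrite (bigD1 (Ordinal mN)) //=.
have S1 : 0 <= \sum_(i < N | i != Ordinal mN) (f i%:Z + f (- i%:Z)).
  by apply: sumr_ge0 => k _; rewrite addr_ge0.
have : f m <= f `|m|%N%:Z + f (- `|m|%N%:Z).
  case: (m) => n; first by rewrite /= lerDl.
  by rewrite NegzE abszN /= lerDr.
have := normr_ge0 L; lra.
Qed.

(** Far to the right [|a Q^m| <= 1/2] and far to the left [|a Q^m| >= 2]; in both ranges
    [|1 - a Q^m| >= 1/2], and finitely many [m] remain. *)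
Lemma inv_bounded a : regular Q a ->
  exists2 L, 0 < L & forall m : int, normc (1 - a * Q ^ m)^-1 <= L.
Proof.
move=> [a0 H].
have na0 : 0 < normc a by rewrite normc_gt0.
have [N1 H1] := exprn_small r01 (y := 2^-1 / normc a) 
  ltac:(by rewrite divr_gt0 // invr_gt0).
have [N2 H2] := exprn_small r01 (y := 2^-1 * normc a) 
  ltac:(by rewrite mulr_gt0 // invr_gt0).
apply: (@int_bounded _ 2 (N1 + N2)) => [m|m mN]; first exact: normc_ge0.
rewrite normcV -[leRHS]invrK lef_pV2 ?posrE ?invr_gt0 ?normc_gt0 //.
case: m mN => n nN.
  have nN1 : (N1 <= n)%N by apply: leq_trans nN; rewrite leq_addr.
  have := H1 n nN1; rewrite ler_pdivlMr // => h.
  have := le_normcD (1 - a * Q ^ n) (a * Q ^ n).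
  by rewrite subrK normc1 normcM -exprnP normcX; lra.
have nN2 : (N2 <= n.+1)%N by apply: leq_trans nN; rewrite leq_addl.
have := H2 n.+1 nN2; rewrite NegzE => h.
have := le_normcD (1 - a * Q ^ - n.+1%:Z) (- 1).
rewrite addrAC subrr add0r !normcN normc1 normcM normcXz -invr_expz -exprnP => h'.
have : 2 <= normc a / r ^+ n.+1.
  by rewrite ler_pdivlMr ?exprn_gt0 //; lra.
lra.
Qed.

Lemma tcoef_dominate (x : C) : x != 0 -> exists K, 0 <= K /\
  forall m : int, normc (tcoef Q m * x ^ m) <= K * r ^+ `|m|%N.
Proof.
move=> x0; have [K HK] := exprz_dominate r01' (x := normc x) ltac:(by rewrite normc_gt0).
exists K; split=> [|m]; last by rewrite normcM normc_tcoef normcXz.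
have := HK 0; rewrite tri0 !expr0z mulr1 /= expr0 mulr1.
exact: le_trans.
Qed.

Let FMK (K : R) : 0 <= K -> bounded_sums (fun m : int => K * r ^+ `|m|%N).
Proof. by move=> K0; apply: bounded_sumsZ K0 (bounded_sums_geo r01). Qed.

Lemma has_jtheta x : x != 0 ->
  has_csum (fun m : int => tcoef Q m * x ^ m) (jtheta Q x).
Proof. by move=> /tcoef_dominate[K [K0 HK]]; apply: csumP (FMK K0) HK. Qed.

(** By [tcoef1B] the reflection [m -> 1 - m] turns the sum into its own negative. *)
Lemma jtheta1 : jtheta Q 1 = 0.
Proof.
have H := has_jtheta (oner_neq0 C).
have b : bijective (fun m : int => 1 - m).
  by exists (fun m : int => 1 - m) => m; ring.
have K := has_csum_reindex b H.
have : jtheta Q 1 = - 1 * jtheta Q 1.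
  apply: (has_csum_unique K); apply: has_csum_eq (has_csumZ (-1) H) => m /=.
  by rewrite tcoef1B // !exp1rz; ring.
by rewrite mulN1r => /eqP; rewrite -addr_eq0 -mulr2n mulrn_eq0 => /eqP.
Qed.

Lemma jthetaM x : x != 0 -> jtheta Q (x * Q) = - x^-1 * jtheta Q x.
Proof.
move=> x0; have H := has_jtheta x0.
have H' := has_jtheta (x := x * Q) ltac:(by rewrite mulf_neq0).
have b : bijective (fun m : int => m + 1).
  by exists (fun m : int => m - 1) => m; ring.
have K := has_csum_reindex b H.
apply: (has_csum_unique H'); apply: has_csum_eq (has_csumZ (- x^-1) K) => m /=.
rewrite tcoefS // expfzMl [x ^ (m + 1)]expfzDr // expr1z.
by field.
Qed.

Lemma jthetaQ : jtheta Q Q = 0.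
Proof. by rewrite -[X in jtheta _ X]mul1r jthetaM ?oner_neq0 // jtheta1 mulr0. Qed.

(* Up to the factor [(Q; Q)_(2N)], the finite form of Jacobi's triple product. *)
Definition jfin (N : nat) (a : C) : C :=
  csum (fun m : int => tcoef Q m * a ^ m * iq2 Q N m).

(** For regular [a] this is the partial fraction expansion of [1 / ((1 - a) prod_(k=1..N) (1 - a
    Q^k) (1 - Q^k / a))], as [afin0] and [afinS] show. *)
Definition afin (N : nat) (a : C) : C :=
  csum (fun m : int => tcoef Q m * Q ^ m / (1 - a * Q ^ m) * iq2 Q N m).

Lemma iq2_ub : exists2 B, 0 < B & forall N m, normc (iq2 Q N m) <= B.
Proof.
have [B [B0 HB]] := iq_ub Q0 Q1; exists (B * B); first exact: mulr_gt0.
by move=> N m; rewrite normcM ler_pM ?normc_ge0.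
Qed.

Lemma iq2_0 m : iq2 Q 0 m = (m == 0)%:R.
Proof.
rewrite /iq2 !add0r; case: m => [[|n]|n].
- by rewrite oppr0 /= qpoch0 invr1 mulr1.
- by rewrite (_ : - n.+1%:Z = Negz n) // mul0r.
- by rewrite mulr0.
Qed.

Lemma jfin_dominate a : a != 0 -> exists K, 0 <= K /\ forall N (m : int),
  normc (tcoef Q m * a ^ m * iq2 Q N m) <= K * r ^+ `|m|%N.
Proof.
move=> /tcoef_dominate[K [K0 HK]]; have [B B0 HB] := iq2_ub.
exists (K * B); split=> [|N m]; first by rewrite mulr_ge0 // ltW.
by rewrite normcM [leRHS]mulrAC ler_pM ?normc_ge0.
Qed.

Lemma appell_dominate a : regular Q a -> exists K, 0 <= K /\ forall (m : int),
  normc (tcoef Q m * Q ^ m / (1 - a * Q ^ m)) <= K * r ^+ `|m|%N.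
Proof.
move=> /inv_bounded[L L0 HL]; have [K [K0 HK]] := tcoef_dominate Q0.
exists (K * L); split=> [|m]; first by rewrite mulr_ge0 // ltW.
by rewrite normcM [leRHS]mulrAC ler_pM ?normc_ge0.
Qed.

Lemma afin_dominate a : regular Q a -> exists K, 0 <= K /\ forall N (m : int),
  normc (tcoef Q m * Q ^ m / (1 - a * Q ^ m) * iq2 Q N m) <= K * r ^+ `|m|%N.
Proof.
move=> /appell_dominate[K [K0 HK]]; have [B B0 HB] := iq2_ub.
exists (K * B); split=> [|N m]; first by rewrite mulr_ge0 // ltW.
by rewrite normcM [leRHS]mulrAC ler_pM ?normc_ge0.
Qed.

Lemma has_jfin N a : a != 0 ->
  has_csum (fun m : int => tcoef Q m * a ^ m * iq2 Q N m) (jfin N a).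
Proof. by move=> /jfin_dominate[K [K0 HK]]; apply: csumP (FMK K0) _ => m. Qed.

Lemma has_afin N a : regular Q a ->
  has_csum (fun m : int => tcoef Q m * Q ^ m / (1 - a * Q ^ m) * iq2 Q N m) (afin N a).
Proof. by move=> /afin_dominate[K [K0 HK]]; apply: csumP (FMK K0) _ => m. Qed.

Lemma jfin0 a : jfin 0 a = 1.
Proof.
apply: has_csum_csum; rewrite -[1](_ : tcoef Q 0 * a ^ 0 * iq2 Q 0 0 = 1).
  by apply: has_csum_delta => m /negPf m0; rewrite iq2_0 m0 mulr0.
by rewrite tcoef0 expr0z iq2_0 eqxx !mulr1.
Qed.

Lemma afin0 a : afin 0 a = (1 - a)^-1.
Proof.
apply: has_csum_csum.
rewrite -[X in has_csum _ X](_ : tcoef Q 0 * Q ^ 0 / (1 - a * Q ^ 0) * iq2 Q 0 0 = _).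
  by apply: has_csum_delta => m /negPf m0; rewrite iq2_0 m0 mulr0.
by rewrite tcoef0 expr0z iq2_0 eqxx !mulr1 mul1r.
Qed.

(** Expanding the right side involves the terms of level [N] at [m], [m - 1] and [m + 1]. All three
    weights are rational multiples of [iq2 Q N.+1 m], so the claim holds coefficient by coefficient
    in [a]. *)
Lemma jfinS N a : a != 0 ->
  (1 - Q ^+ (2 * N).+1) * (1 - Q ^+ (2 * N).+2) * jfin N.+1 a =
  (1 - a * Q ^+ N) * (1 - Q ^+ N.+1 / a) * jfin N a.
Proof.
move=> a0; have H := has_jfin N a0.
have bS : bijective (fun m : int => m + 1).
  by exists (fun m : int => m - 1) => m; ring.
have bP : bijective (fun m : int => m - 1).
  by exists (fun m : int => m + 1) => m; ring.
apply: (has_csum_unique (has_csumZ _ (has_jfin N.+1 a0))).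
have -> : (1 - a * Q ^+ N) * (1 - Q ^+ N.+1 / a) * jfin N a =
   (1 + Q ^+ (2 * N).+1) * jfin N a + - (a * Q ^+ N) * jfin N a +
   - (Q ^+ N.+1 / a) * jfin N a.
  by rewrite [Q ^+ (2 * N).+1]exprS exprM exprS expr2 exprMn; field.
apply: has_csum_eq (has_csumD (has_csumD (has_csumZ _ H) (has_csumZ _ (has_csum_reindex bP H)))
  (has_csumZ _ (has_csum_reindex bS H))) => m /=.
have E1 : tcoef Q m = - Q ^ (m - 1) * tcoef Q (m - 1).
  by rewrite -tcoefS // subrK.
have QmP : Q ^ (m - 1) = Q ^ m / Q by rewrite expfzDr // -invr_expz expr1z.
have Qm0 : Q ^ m != 0 by rewrite expfz_neq0.
have E2 : tcoef Q (m - 1) = - Q / Q ^ m * tcoef Q m.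
  by rewrite E1 QmP; field; rewrite Q0.
rewrite tcoefS // E2 !expfzDr // -[a ^ (-1)]invr_expz !expr1z.
rewrite (iq2_center Q0 Q1 N m).
have X1 : iq2 Q N (m - 1) = iq2 Q N.+1 m *
    ((1 - Q ^+ N * Q ^ m) * (1 - Q ^+ N.+1 * Q ^ m)).
  rewrite /iq2.
  have -> : N%:Z - (m - 1) = N.+1%:Z - m by lia.
  rewrite (iq_rec Q0 Q1 (N%:Z + (m - 1))).
  have -> : N%:Z + (m - 1) + 1 = N%:Z + m by lia.
  rewrite (iq_rec Q0 Q1 (N%:Z + m)).
  have -> : N%:Z + m + 1 = N.+1%:Z + m by lia.
  by rewrite !expfzDr // -!exprnP; ring.
have X2 : iq2 Q N (m + 1) = iq2 Q N.+1 m *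
    ((1 - Q ^+ N / Q ^ m) * (1 - Q ^+ N.+1 / Q ^ m)).
  rewrite /iq2.
  have -> : N%:Z + (m + 1) = N.+1%:Z + m by lia.
  rewrite (iq_rec Q0 Q1 (N%:Z - (m + 1))).
  have -> : N%:Z - (m + 1) + 1 = N%:Z - m by lia.
  rewrite (iq_rec Q0 Q1 (N%:Z - m)).
  have -> : N%:Z - m + 1 = N.+1%:Z - m by lia.
  by rewrite !expfzDr // -!invr_expz -!exprnP; ring.
rewrite X1 X2 !exprS exprM expr2 exprMn.
by field; rewrite Qm0 a0.
Qed.

(** The zeros at [1] and [Q] enter at the step from level [0] to level [1], through the factors
    [1 - a] and [1 - Q / a], and the recurrence propagates them. *)
Lemma jfin_eq0 N : jfin N.+1 1 = 0 /\ jfin N.+1 Q = 0.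
Proof.
have step M a : a != 0 -> (1 - a * Q ^+ M) * (1 - Q ^+ M.+1 / a) * jfin M a = 0 ->
    jfin M.+1 a = 0.
  move=> a0; rewrite -jfinS // => /eqP; rewrite mulf_eq0 => /orP[|/eqP //].
  by rewrite mulf_eq0 !(negPf (oneBQ_neq0 Q1 _)).
elim: N => [|N [IH1 IH2]]; split; apply: step => //; rewrite ?oner_neq0 //.
- by rewrite expr0 mulr1 subrr !mul0r.
- by rewrite expr1 divff // subrr mulr0 mul0r.
- by rewrite IH1 mulr0.
- by rewrite IH2 mulr0.
Qed.

(* The defect of the recurrence is a combination of [jfin N.+1 1] and
   [jfin N.+1 Q], which vanish by the triple product. *)
Lemma afinS N a : regular Q a ->
  (1 - a * Q ^+ N.+1) * (1 - Q ^+ N.+1 / a) * afin N.+1 a = afin N a.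
Proof.
move=> ra; have [a0 Ha] := ra; have [J1 J2] := jfin_eq0 N.
have H1 := has_jfin N.+1 (oner_neq0 C); have H2 := has_jfin N.+1 Q0.
rewrite J1 in H1; rewrite J2 in H2.
have := has_csumD (has_csumZ (Q ^+ N.+1) H1) (has_csumZ (- (Q ^+ N.+1 / a)) H2).
rewrite !mulr0 addr0 => H3.
have := has_csumB (has_csumZ ((1 - a * Q ^+ N.+1) * (1 - Q ^+ N.+1 / a))
  (has_afin N.+1 ra)) (has_afin N ra).
move=> H4; apply/eqP; rewrite -subr_eq0; apply/eqP; apply: (has_csum_unique H4).
apply: has_csum_eq H3 => m; rewrite (iq2_center Q0 Q1 N m) exp1rz.
have Qm0 : Q ^ m != 0 by rewrite expfz_neq0.
by field; rewrite Qm0 a0 Ha.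
Qed.

(** The step of [jfin] contributes [1 - a Q^N] and that of [afin] removes [1 - a Q^(N+1)]: the two
    products are out of step by one factor, which the last factor here repairs. *)
Lemma jfin_afin N a : regular Q a ->
  jfin N a * afin N a * qpoch Q (2 * N) * (1 - a * Q ^+ N) = 1.
Proof.
move=> ra; have [a0 Ha] := ra.
elim: N => [|N IH].
  rewrite jfin0 afin0 muln0 qpoch0 expr0 !mulr1 mul1r mulVf //.
  by have := Ha 0; rewrite expr0z mulr1.
rewrite (_ : (2 * N.+1 = (2 * N).+2)%N); last by lia.
rewrite !qpochS.
transitivity (((1 - Q ^+ (2 * N).+1) * (1 - Q ^+ (2 * N).+2) * jfin N.+1 a)
  * afin N.+1 a * qpoch Q (2 * N) * (1 - a * Q ^+ N.+1)); first by ring.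
by rewrite jfinS // -[RHS]IH -(afinS N ra); ring.
Qed.

(** In the limit of [jfin_afin] each of the two sums carries [P^(-2)] and [(Q; Q)_(2N)] carries [P],
    which leaves [P^3]. The majorants of both sums are uniform in [N]. *)
Lemma jtheta_appell P a : P != 0 -> tends \oo (qpoch Q) P ->
  (forall m : int, tends \oo (fun N : nat => iq Q (N%:Z + m)) P^-1) ->
  regular Q a -> jtheta Q a * appell Q a = P ^+ 3.
Proof.
move=> P0 HP Hiq ra; have [a0 Ha] := ra.
have Hu m : tends \oo (fun N => iq2 Q N m) (P^-1 * P^-1) by apply: tendsM.
have [K [K0 HK]] := jfin_dominate a0.
have [L [L0 HL]] := afin_dominate ra.
have TJ : tends \oo (fun N => jfin N a) (jtheta Q a * (P^-1 * P^-1)).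
  have -> : jtheta Q a * (P^-1 * P^-1) = csum (fun m => tcoef Q m * a ^ m * (P^-1 * P^-1)).
    exact/esym/has_csum_csum/has_csumMr/has_jtheta.
  apply: (tends_csum (FMK K0)); first by apply: nearW.
  by move=> m; apply: tendsZ.
have TA : tends \oo (fun N => afin N a) (appell Q a * (P^-1 * P^-1)).
  have -> : appell Q a * (P^-1 * P^-1) =
     csum (fun m => tcoef Q m * Q ^ m / (1 - a * Q ^ m) * (P^-1 * P^-1)).
    have [M [M0 HM]] := appell_dominate ra.
    exact/esym/has_csum_csum/has_csumMr/(csumP (FMK M0) HM).
  apply: (tends_csum (FMK L0)); first by apply: nearW.
  by move=> m; apply: tendsZ.
have TP : tends \oo (fun N => qpoch Q (2 * N)) P.
  move=> e /HP[n _ Hn]; exists n => // N /= nN; apply: (Hn (2 * N)%N).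
  by rewrite /=; lia.
have TQ : tends \oo (fun N => 1 - a * Q ^+ N) (1 - a * 0).
  apply: tendsB (tends_cst 1) (tendsZ a _) => e e0.
  have pow0 : (r ^+ n @[n --> \oo] --> (0 : R)).
    by apply: cvg_expr; rewrite ger0_norm // ltW.
  move/cvgrPdist_lt : pow0 => /(_ e e0); apply: filterS => n.
  by rewrite sub0r normrN subr0 normcX ger0_norm // exprn_ge0 // ltW.
have E : jtheta Q a * (P^-1 * P^-1) * (appell Q a * (P^-1 * P^-1)) * P * (1 - a * 0) = 1.
  apply: (tends_unique (tendsM (tendsM (tendsM TJ TA) TP) TQ)); apply: tends_eq (tends_cst 1).
  by apply: nearW => N; rewrite jfin_afin.
have -> : P ^+ 3 = P ^+ 3 * 1 by rewrite mulr1.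
by rewrite -E; field.
Qed.
End Qfix.
End Theta.

(** * Kronecker's formula *)
Section Kronecker.
Variable R : realType.
Local Notation C := R[i].

Definition kron (Q a b : C) : C := csum (fun n : int => b ^ n / (1 - a * Q ^ n)).

Section Qfix.
Variable Q : C.
Hypothesis Q0 : Q != 0.
Hypothesis Q1 : normc Q < 1.
Local Notation r := (normc Q).

Let r_gt0 : 0 < r := nome_gt0 Q0.
Let r01 : 0 <= r < 1. Proof. by rewrite (ltW r_gt0) Q1. Qed.

Lemma regular_normc a : a != 0 -> (forall m : int, normc (a * Q ^ m) != 1) ->
  regular Q a.
Proof.
move=> a0 H; split=> // m; rewrite subr_eq0; apply: contra (H m) => /eqP <-.
by rewrite normc1.
Qed.

Lemma regular_annulus b : r < normc b < 1 -> regular Q b.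
Proof.
move=> /andP[b1 b2]; have b0 : 0 < normc b := lt_trans r_gt0 b1.
apply: regular_normc => [|m]; first by rewrite -normc_gt0.
rewrite normcM normcXz; case: m => n.
  rewrite lt_eqF // (le_lt_trans _ b2) // ler_piMr ?(ltW b0) //.
  by rewrite -exprnP exprn_ile1 // ltW.
rewrite gt_eqF // NegzE -invr_expz -exprnP ltr_pdivlMr ?exprn_gt0 // mul1r.
by apply: le_lt_trans b1; rewrite exprS ler_piMr ?(ltW r_gt0) // exprn_ile1 // ltW.
Qed.

(** For [n >= 0] the decay is that of [|b|^n]; for [n < 0] the denominator grows like [Q^n] and the
    decay is that of [|Q / b|^|n|]. The annulus makes both ratios less than [1]. *)
Lemma kron_dominate a b : regular Q a -> r < normc b < 1 ->
  exists K rho, [/\ 0 <= K, 0 <= rho < 1 &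
    forall n : int, normc (b ^ n / (1 - a * Q ^ n)) <= K * rho ^+ `|n|%N].
Proof.
move=> ra /andP[b1 b2]; have b0 : 0 < normc b := lt_trans r_gt0 b1.
have nb0 : b != 0 by rewrite -normc_gt0.
have [a0 Ha] := ra; have rV := regularV ra.
have [L L0 HL] := inv_bounded Q0 Q1 ra.
have [M M0 HM] := inv_bounded Q0 Q1 rV.
pose rho := Num.max (normc b) (r / normc b).
have rho0 : 0 <= rho by rewrite le_max (ltW b0).
exists (L + normc a^-1 * M), rho; split.
- by rewrite addr_ge0 ?mulr_ge0 ?normc_ge0 // ltW.
- by rewrite rho0 gt_max b2 ltr_pdivrMr // mul1r.
case=> n.
  rewrite normcM mulrC ler_pM ?normc_ge0 //.
    by rewrite (le_trans (HL _)) // lerDl mulr_ge0 ?normc_ge0 // ltW.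
  by rewrite normcXz -exprnP lerXn2r ?nnegrE ?normc_ge0 // le_max lexx.
(* Pulling [a Q^n] out of the denominator leaves the same kind of denominator with [a^-1], bounded
   through [regularV]. *)
have E : b ^ (Negz n) / (1 - a * Q ^ (Negz n)) =
   - (a^-1 / (1 - a^-1 * Q ^ n.+1)) * (Q / b) ^+ n.+1.
  rewrite NegzE -!invr_expz -!exprnP exprMn exprVn.
  have h1 := rV.2 n.+1; have h2 := Ha (- n.+1%:Z); rewrite -invr_expz in h2.
  have gen (x y : C) : x != 0 -> y != 0 -> 1 - a^-1 * x != 0 -> 1 - a / x != 0 ->
      y^-1 / (1 - a / x) = - (a^-1 / (1 - a^-1 * x)) * (x / y).
    move=> x0 y0 h3 h4; field; rewrite a0 x0 y0 /=.
    have -> : x - a = x * (1 - a / x) by field.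
    have -> : a - x = a * (1 - a^-1 * x) by field.
    by rewrite !mulf_neq0.
  by apply: gen => //; rewrite expf_neq0.
rewrite E (_ : `|Negz n|%N = n.+1) //.
rewrite normcM normcN normcX ler_pM ?normc_ge0 ?exprn_ge0 ?normc_ge0 //.
  by rewrite normcM (le_trans (ler_wpM2l (normc_ge0 _) (HM _))) // lerDr ltW.
by rewrite lerXn2r ?nnegrE ?normc_ge0 // normcM normcV le_max lexx orbT.
Qed.

Definition kcoef (a : C) (N : int) : C :=
  csum (fun m : int => tcoef Q m / (1 - a * Q ^ (N - m))).

Lemma has_kcoef a N : regular Q a ->
  has_csum (fun m : int => tcoef Q m / (1 - a * Q ^ (N - m))) (kcoef a N).
Proof.
move=> ra; have [L L0 HL] := inv_bounded Q0 Q1 ra.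
have [K [K0 HK]] := tcoef_dominate Q0 Q1 (oner_neq0 C).
apply: (@csumP _ _ (fun m : int => L * (K * r ^+ `|m|%N))).
  by apply: bounded_sumsZ (ltW L0) (bounded_sumsZ K0 (bounded_sums_geo r01)).
move=> m; rewrite normcM mulrC ler_pM ?normc_ge0 //.
by have := HK m; rewrite exp1rz mulr1.
Qed.

(** The shift [m -> m + 1] makes the denominators agree. Since [a Q^N = Q^m (a Q^(N-m))], the
    numerator then cancels the denominator and [- tcoef m Q^m] remains, the series of
    [- jtheta Q Q]. *)
Lemma kcoefS a N : regular Q a -> kcoef a (N + 1) = - (a * Q ^ N) * kcoef a N.
Proof.
move=> ra; have [a0 Ha] := ra.
have bS : bijective (fun m : int => m + 1).
  by exists (fun m : int => m - 1) => m; ring.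
have H1 := has_csum_reindex bS (has_kcoef (N + 1) ra).
have H2 := has_csumZ (- (a * Q ^ N)) (has_kcoef N ra).
have := has_csumB H1 H2.
have H3 := has_jtheta Q0 Q1 Q0; rewrite (jthetaQ Q0 Q1) in H3.
move=> H4; apply/eqP; rewrite -subr_eq0; apply/eqP; apply: (has_csum_unique H4).
rewrite -(mulr0 (-1)); apply: has_csum_eq (has_csumZ (-1) H3) => m /=.
have -> : N + 1 - (m + 1) = N - m by ring.
have h := Ha (N - m).
have E : a * Q ^ N = Q ^ m * (a * Q ^ (N - m)).
  by rewrite mulrCA -expfzDr // addrC subrK.
by rewrite E tcoefS //; field.
Qed.

Lemma kcoef0 a : regular Q a -> kcoef a 0 = appell Q a.
Proof.
move=> ra; have b : bijective (fun m : int => - m).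
  by exists (fun m : int => - m) => m; rewrite opprK.
have H := has_csum_reindex b (has_kcoef 0 ra).
apply/esym/has_csum_csum; apply: has_csum_eq H => m /=.
by rewrite tcoefN // opprK add0r [Q ^ m * _]mulrC.
Qed.

Lemma kcoefE a N : regular Q a -> kcoef a N = tcoef Q N * a ^ N * appell Q a.
Proof.
move=> ra; have [a0 _] := ra; move: N; apply: int_ind_iff => [|N].
  by rewrite kcoef0 // tcoef0 expr0z !mul1r.
have n0 : - (a * Q ^ N) != 0 by rewrite oppr_eq0 mulf_neq0 // expfz_neq0.
rewrite kcoefS // tcoefS // expfzDr // expr1z.
have -> : - Q ^ N * tcoef Q N * (a ^ N * a) * appell Q a =
  - (a * Q ^ N) * (tcoef Q N * a ^ N * appell Q a) by ring.
by split=> [->|/(mulfI n0)].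
Qed.

(* [kcoef a N] is the coefficient of [b ^ N] in [kron Q a b * jtheta Q b]. *)
Lemma kron_jtheta a b : regular Q a -> r < normc b < 1 ->
  kron Q a b * jtheta Q b = appell Q a * jtheta Q (a * b).
Proof.
move=> ra hb; have [b0 _] := regular_annulus hb; have [a0 _] := ra.
have [K [rho [K0 rho01 HK]]] := kron_dominate ra hb.
have [M [M0 HM]] := tcoef_dominate Q0 Q1 b0.
pose G (p : int * int) := b ^ p.1 / (1 - a * Q ^ p.1) * (tcoef Q p.2 * b ^ p.2).
have F1 := bounded_sumsZ K0 (bounded_sums_geo rho01).
have F2 := bounded_sumsZ M0 (bounded_sums_geo r01).
have F := bounded_sumsM F1 F2.
have GM p : normc (G p) <= (K * rho ^+ `|p.1|%N) * (M * r ^+ `|p.2|%N).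
  by rewrite normcM ler_pM ?normc_ge0.
have HG := csumP F GM.
have S1 : csum G = kron Q a b * jtheta Q b.
  apply: (has_csum_unique (csum_Fubini F GM)).
  apply: has_csum_eq (has_csumMr (jtheta Q b) (csumP F1 HK)) => n.
  by rewrite -(has_csum_csum (has_csumZ (b ^ n / (1 - a * Q ^ n)) (has_jtheta Q0 Q1 b0))).
(* The pair becomes [(N, m)] with [N] the total power of [b], so that Fubini collects the
   coefficient of [b ^ N]. *)
have bij : bijective (fun p : int * int => (p.1 - p.2, p.2)).
  by exists (fun p : int * int => (p.1 + p.2, p.2)) => -[x y] /=; rewrite ?subrK ?addrK.
have H2 := has_csum_reindex bij HG.
have H3 : has_csum (fun N : int => b ^ N * kcoef a N) (csum G).
  apply: has_csum_Fubini H2 _ => N.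
  apply: has_csum_eq (has_csumZ (b ^ N) (has_kcoef N ra)) => m /=.
  have -> : b ^ N = b ^ (N - m) * b ^ m by rewrite -expfzDr // subrK.
  by rewrite /G /=; ring.
rewrite -S1; apply: (has_csum_unique H3).
have ab0 : a * b != 0 by rewrite mulf_neq0.
apply: has_csum_eq (has_csumZ (appell Q a) (has_jtheta Q0 Q1 ab0)) => N.
rewrite kcoefE // expfzMl.
by move: (appell Q a) (tcoef Q N) (a ^ N) (b ^ N) => x y z t; ring.
Qed.

(** Under [b -> b Q] the quasi-period factors of [jtheta Q (a b)] and [jtheta Q b] differ exactly by
    [a^-1]. *)
Lemma jtheta_shift a b (k : int) : a != 0 -> b != 0 ->
  jtheta Q (a * (b * Q ^ k)) * jtheta Q b * a ^ k = jtheta Q (a * b) * jtheta Q (b * Q ^ k).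
Proof.
move=> a0 b0; move: k; apply: int_ind_iff => [|k].
  by rewrite expr0z !mulr1.
have qk : Q ^ k != 0 by rewrite expfz_neq0.
have E1 : jtheta Q (b * Q ^ (k + 1)) = - (b * Q ^ k)^-1 * jtheta Q (b * Q ^ k).
  have -> : b * Q ^ (k + 1) = b * Q ^ k * Q by rewrite expfzDr // expr1z mulrA.
  by apply: jthetaM => //; apply: mulf_neq0.
have E2 : jtheta Q (a * (b * Q ^ (k + 1))) =
    - (a * (b * Q ^ k))^-1 * jtheta Q (a * (b * Q ^ k)).
  have -> : a * (b * Q ^ (k + 1)) = a * (b * Q ^ k) * Q.
    by rewrite expfzDr // expr1z -[RHS]mulrA -[b * _ * Q]mulrA.
  by apply: jthetaM => //; apply: mulf_neq0 => //; apply: mulf_neq0.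
rewrite {}E1 {}E2 [a ^ (k + 1)]expfzDr // expr1z.
have n0 : - (b * Q ^ k)^-1 != 0 by rewrite oppr_eq0 invr_eq0 mulf_neq0.
move: (jtheta Q (a * (b * Q ^ k))) (jtheta Q b) (jtheta Q (a * b)) (jtheta Q (b * Q ^ k)).
move: (Q ^ k) (a ^ k) qk n0 => q ak q0 n0 x y z t.
have -> : - (a * (b * q))^-1 * x * y * (ak * a) = - (b * q)^-1 * (x * y * ak).
  by field; rewrite a0 b0 q0.
rewrite [z * (_ * t)]mulrCA.
by split=> [->|/(mulfI n0)].
Qed.

(** No product formula for the infinite series is needed: the product with [appell] is [P^3], which
    is nonzero. *)
Lemma jtheta_neq0 a : regular Q a -> jtheta Q a != 0.
Proof.
move=> ra; have [P [P0 HP Hiq]] := qpoch_cvg Q0 Q1.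
have := jtheta_appell Q0 Q1 P0 HP Hiq ra.
by apply: contra_eq_neq => ->; rewrite mul0r eq_sym expf_neq0.
Qed.

(** Continues Kronecker's formula beyond the annulus: [a ^ k] compensates the shift of [b], by
    [jtheta_shift], so the right side does not depend on [k]. *)
Lemma kronecker P a b (k : int) : tends \oo (qpoch Q) P ->
  regular Q a -> r < normc (b * Q ^ k) < 1 -> regular Q b ->
  a ^ k * kron Q a (b * Q ^ k) =
  P ^+ 3 * jtheta Q (a * b) / (jtheta Q a * jtheta Q b).
Proof.
move=> HP ra hb rb.
have [P' [P0 HP' Hiq]] := qpoch_cvg Q0 Q1.
have -> : P = P' := tends_unique HP HP'.
have ja := jtheta_neq0 ra; have jb := jtheta_neq0 rb.
have jbk := jtheta_neq0 (regular_annulus hb).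
have H1 := jtheta_appell Q0 Q1 P0 HP' Hiq ra.
have H2 := kron_jtheta ra hb.
have [a0 _] := ra; have [b0 _] := rb.
have H3 := jtheta_shift k a0 b0.
rewrite -H1; apply: (mulIf jbk); apply: (mulIf jb).
move: H2 H3 ja jb jbk.
move: (jtheta Q (a * (b * Q ^ k))) (jtheta Q b) (jtheta Q (a * b)) (jtheta Q (b * Q ^ k))
  (jtheta Q a) (kron Q a (b * Q ^ k)) (appell Q a) (a ^ k) => x y z t w f g h.
move=> H2 H3 w0 y0 t0.
have -> : h * f * t * y = h * (f * t) * y by ring.
rewrite H2.
have -> : h * (g * x) * y = g * (x * y * h) by ring.
by rewrite H3; field; rewrite w0 y0.
Qed.
End Qfix.
End Kronecker.

(** * The theta and eta functions *)
Section Exponentials.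
Variable R : realType.
Local Notation C := R[i].

Lemma cexpD (z w : C) : cexp (z + w) = cexp z * cexp w.
Proof.
case: z => a b; case: w => c d; rewrite /cexp /= expRD cosD sinD.
by simpc; congr (_ +i* _); ring.
Qed.

Lemma cexp0 : cexp (0 : C) = 1.
Proof. by rewrite /cexp /= expR0 cos0 sin0; simpc. Qed.

Lemma normc_cexp (z : C) : normc (cexp z) = expR (complex.Re z).
Proof.
case: z => a b; rewrite /cexp normcM normc_real /= (ger0_norm (expR_ge0 _)).
by rewrite cos2Dsin2 sqrtr1 mulr1.
Qed.

Lemma e2piD (z w : C) : e2pi (z + w) = e2pi z * e2pi w.
Proof. by rewrite /e2pi mulrDr cexpD. Qed.

Lemma e2pi0 : e2pi (0 : C) = 1.
Proof. by rewrite /e2pi mulr0 cexp0. Qed.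

Lemma e2pi_neq0 (z : C) : e2pi z != 0.
Proof.
by apply: contra_eq_neq e2pi0 => z0; rewrite -(subrr z) e2piD z0 mul0r eq_sym oner_neq0.
Qed.

Lemma e2piZ (n : int) (z : C) : e2pi (n%:~R * z) = e2pi z ^ n.
Proof.
move: n; apply: int_ind_iff => [|n]; first by rewrite mul0r e2pi0.
rewrite intrD mulrDl mul1r e2piD expfzDr ?e2pi_neq0 // expr1z.
by split=> [->//|/(mulIf (e2pi_neq0 z))].
Qed.

Lemma e2piX (n : nat) (z : C) : e2pi (n%:R * z) = e2pi z ^+ n.
Proof. by rewrite -[n%:R]/((n%:Z)%:~R) e2piZ. Qed.

Lemma normc_e2pi (z : C) : normc (e2pi z) = expR (- (2 * pi) * complex.Im z).
Proof.
case: z => a b; rewrite /e2pi normc_cexp /=; congr expR.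
ring.
Qed.

Lemma e2pi_quarter : e2pi (4^-1 : C) = 'i%C.
Proof.
rewrite /e2pi.
have -> : 2%:R * pi%:C * 'i%C * 4^-1 = 0 +i* (pi / 2) :> C.
  have -> : 4^-1 = (4^-1)%:C :> C by rewrite fmorphV rmorph_nat.
  have -> : 2%:R = (2%:R)%:C :> C by rewrite rmorph_nat.
  by simpc; congr (_ +i* _); field.
by rewrite /cexp /= expR0 cos_pihalf sin_pihalf; simpc.
Qed.

Lemma e2pi_half : e2pi (2^-1 : C) = -1.
Proof.
have -> : 2^-1 = 4^-1 + 4^-1 :> C by field.
by rewrite e2piD e2pi_quarter -expr2 sqr_i.
Qed.

Lemma normc_qpow (tau : C) (s : R) :
  normc (qpow tau s) = expR (- (2 * pi) * (s * complex.Im tau)).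
Proof.
rewrite normc_e2pi; congr (expR (_ * _)); case: tau => a b /=.
by rewrite mul0r addr0.
Qed.

Lemma zetaX (z : C) (n : nat) : zeta z ^+ n = e2pi (n%:R * z).
Proof. by rewrite e2piX. Qed.

Lemma qpow_neq0 (tau : C) (s : R) : qpow tau s != 0.
Proof. exact: e2pi_neq0. Qed.

Lemma normc_qpow_lt1 (tau : C) (s : R) : 0 < complex.Im tau -> 0 < s ->
  normc (qpow tau s) < 1.
Proof.
move=> t0 s0; rewrite normc_qpow expR_lt1 mulNr oppr_lt0.
by rewrite !mulr_gt0 // pi_gt0.
Qed.

(** Since [(m + 1/2)^2 / 2 = tri (m + 1) + 1/8], the index is shifted by one; this costs the factor
    [- (zeta z ^+ 3)^-1]. The half-integer part of the index leaves [3/8 tau], [3/2 z] and [1/4]. *)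
Lemma thetaE (z tau : C) : 0 < complex.Im tau ->
  theta (3%:R * z) (3%:R * tau) = - (zeta z ^+ 3)^-1 *
    e2pi (3%:R / 8%:R * tau + 3%:R / 2%:R * z + 4^-1) *
    jtheta (qpow tau 3%:R) (zeta z ^+ 3).
Proof.
move=> t0; have z0 : zeta z ^+ 3 != 0 by rewrite expf_neq0 // e2pi_neq0.
have Q1 : normc (qpow tau 3%:R) < 1 by apply: normc_qpow_lt1.
set c := _ * e2pi _.
have b : bijective (fun m : int => m + 1).
  by exists (fun m : int => m - 1) => m; ring.
have H := has_csum_reindex b (has_jtheta (qpow_neq0 tau 3%:R) Q1 z0).
apply: has_csum_csum; apply: has_csum_eq (has_csumZ c H) => m /=.
rewrite {}/c /tcoef !(expfzDr m 1) ?oppr_eq0 ?oner_neq0 // !expr1z.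
set E0 := e2pi (_ + 4^-1); set q := qpow tau 3%:R ^ _.
have -> : - (zeta z ^+ 3)^-1 * E0 * ((-1) ^ m * -1 * q * ((zeta z ^+ 3) ^ m * zeta z ^+ 3)) =
  E0 * (-1) ^ m * q * (zeta z ^+ 3) ^ m.
  by move: z0 ((-1) ^ m) ((zeta z ^+ 3) ^ m) => _ x y; field; exact: e2pi_neq0.
have qE : q = e2pi ((tri (m + 1))%:~R * (3%:R * tau)).
  by rewrite e2piZ /q /qpow rmorph_nat.
have tE : (tri (m + 1))%:~R = m%:~R * (m%:~R + 1) / 2 :> C.
  have /(congr1 (fun x : int => x%:~R : C)) := triE (m + 1).
  rewrite !intrM intrD addrK => h.
  by rewrite [m%:~R * _]mulrC -h; field.
rewrite {}qE /E0 -e2pi_half zetaX -!e2piZ /qpow -!e2piD; congr e2pi.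
rewrite tE !rmorphE /= !(rmorphM, rmorphXn, rmorphD, fmorphV, rmorph_int, rmorph_nat) /=.
by move: (m%:~R : C) => M; field.
Qed.

Lemma etaE (tau P : C) : tends \oo (qpoch (qpow tau 3%:R)) P ->
  eta (3%:R * tau) ^+ 3 = e2pi (3%:R / 8%:R * tau) * P ^+ 3.
Proof.
move=> HP; rewrite /eta.
have H : tends \oo (fun N => \prod_(1 <= n < N.+1) (1 - qpow (3%:R * tau) n%:R)) P.
  apply: tends_eq HP; apply: nearW => N; apply: eq_bigr => n _; congr (1 - _).
  by rewrite /qpow -e2piX !rmorph_nat.
move/tends_cvg : H => H; rewrite (cvg_lim (@norm_hausdorff C C^o) H).
rewrite exprMn; congr (_ * _); rewrite /qpow -e2piX; congr e2pi.
by rewrite fmorphV rmorph_nat; field.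
Qed.

Lemma theta_quotient (tau z1 z2 P : C) : 0 < complex.Im tau ->
  let Q := qpow tau 3%:R in let a := zeta z1 ^+ 3 in let b := zeta z2 ^+ 3 in
  tends \oo (qpoch Q) P -> regular Q a -> regular Q b ->
  - 'i%C * (eta (3%:R * tau) ^+ 3 * theta (3%:R * (z1 + z2)) (3%:R * tau) /
          (theta (3%:R * z1) (3%:R * tau) * theta (3%:R * z2) (3%:R * tau))) =
  P ^+ 3 * jtheta Q (a * b) / (jtheta Q a * jtheta Q b).
Proof.
move=> t0 Q a b HP ra rb; have Q0 : Q != 0 := qpow_neq0 _ _.
have Q1 : normc Q < 1 by apply: normc_qpow_lt1.
have ja := jtheta_neq0 Q0 Q1 ra; have jb := jtheta_neq0 Q0 Q1 rb.
have [a0 _] := ra; have [b0 _] := rb.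
rewrite !thetaE // (etaE HP) -/Q -/a -/b.
have -> : zeta (z1 + z2) ^+ 3 = a * b by rewrite /zeta e2piD exprMn.
set x := e2pi (3%:R / 8%:R * tau) ; set y1 := e2pi (_ + 3%:R / 2%:R * z1 + _);
set y2 := e2pi (_ + 3%:R / 2%:R * z2 + _); set y := e2pi (_ + _ * (z1 + z2) + _).
have y10 : y1 != 0 := e2pi_neq0 _.
have y20 : y2 != 0 := e2pi_neq0 _.
(* Origin of the factor [- i]: the eta cube supplies the missing [3/8 tau], and the denominator has
   one more quarter, [e2pi (1/4) = i], than the numerator. *)
have E : x * y * 'i%C = y1 * y2.
  rewrite -e2pi_quarter -!e2piD; congr e2pi; by field.
move: ja jb {HP ra rb} (jtheta Q (a * b)).
move: (jtheta Q a) (jtheta Q b) => A B A0 B0 D.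
move: (P ^+ 3) (a) (b) (x) (y) (y1) (y2) a0 b0 y10 y20 E.
move=> {P a b x y y1 y2} P a b x y y1 y2 a0 b0 y10 y20 E.
have ii : 'i%C * 'i%C = -1 :> C by have := sqr_i R; rewrite expr2.
have E' : x * y = - 'i%C * (y1 * y2).
  rewrite -E (_ : - 'i%C * (x * y * 'i%C) = - (x * y) * ('i%C * 'i%C)); last by ring.
  by rewrite ii mulrN1 opprK.
have -> : - 'i%C * (x * P * (- (a * b)^-1 * y * D) /
   (- a^-1 * y1 * A * (- b^-1 * y2 * B))) =
   - 'i%C * (x * y) * (- P * D) / (y1 * y2 * A * B).
  by field; rewrite A0 B0 a0 b0 y10 y20.
rewrite E'.
have -> : - 'i%C * (- 'i%C * (y1 * y2)) = - (y1 * y2) :> C.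
  by rewrite mulrA mulrNN ii mulN1r.
by field; rewrite A0 B0 y10 y20.
Qed.
End Exponentials.

(** * Jumps of [g4] *)
Section Jumps.
Variable R : realType.
Local Notation C := R[i].

Lemma expRXz (x : R) (n : int) : expR x ^ n = expR (n%:~R * x).
Proof.
have ne y : expR y != 0 :> R by rewrite gt_eqF // expR_gt0.
move: n; apply: int_ind_iff => [|n]; first by rewrite mul0r expR0.
rewrite intrD mulrDl mul1r expRD expfzDr // expr1z.
by split=> [->//|/(mulIf (ne x))].
Qed.

(* [|q^quad(s)|] is, up to a factor independent of [n], the modulus of the term
   of [g4] at [s = n + y / v]. *)
Definition quad (s1 s2 s3 : R) : R := 3%:R * s1 * s2 - 3%:R / 2%:R * s3 ^+ 2.

Lemma normc_g4_term (z1 z2 z3 tau : C) (n1 n2 n3 : int) (v := complex.Im tau)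
    (y1 := complex.Im z1) (y2 := complex.Im z2) (y3 := complex.Im z3) : 0 < v ->
  normc (g4_term z1 z2 z3 tau (n1, n2, n3)) =
  expR (2%:R * pi * v *
    (quad (y1 / v) (y2 / v) (y3 / v) -
     quad (Defs.shift v y1 n1) (Defs.shift v y2 n2) (Defs.shift v y3 n3))).
Proof.
move=> v0; rewrite /g4_term.
have norm4 (x y z t : C) : normc (x * y * z * t) = normc x * normc y * normc z * normc t.
  by rewrite !normcM.
rewrite norm4 normc_qpow; rewrite !(normcXz (zeta _)) /zeta !normc_e2pi !expRXz -!expRD.
congr expR; rewrite /quad /Defs.shift !(intrM, intrN) -/v -/y1 -/y2 -/y3.
by field; rewrite gt_eqF.
Qed.

(** On [S1] alone [quad] is not coercive: it vanishes on the ray [s2 = s3 = 0]. The bounds by [d]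
    remove this degeneracy. *)
Definition far (d s1 s2 s3 : R) : bool := [&& S1 s1 s2 s3, d <= s1 & d <= s2].

(** From [s3^2 <= s1 s2] follows [quad >= 3/2 s1 s2], and [s1 s2] dominates each of [d s1], [d s2],
    [d s3]; averaging the three gives [d / 2]. *)
Lemma quad_far d s1 s2 s3 : 0 < d -> far d s1 s2 s3 ->
  d / 2 * (`|s1| + `|s2| + `|s3|) <= quad s1 s2 s3.
Proof.
move=> d0 /andP[/and3P[h1 h2 h3] /andP[h4 h5]].
have s10 : 0 <= s1 := le_trans (ltW d0) h4; have s20 : 0 <= s2 := le_trans (ltW d0) h5.
rewrite !ger0_norm // /quad.
have H1 : d * s2 <= s1 * s2 by rewrite ler_wpM2r.
have H2 : d * s1 <= s1 * s2 by rewrite [s1 * s2]mulrC ler_wpM2r.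
have H3 : d * s3 <= d * s1 by rewrite ler_wpM2l // ltW.
have H4 : s3 ^+ 2 <= s1 * s2 by rewrite expr2 ler_pM.
lra.
Qed.

Lemma quadN s1 s2 s3 : quad (- s1) (- s2) (- s3) = quad s1 s2 s3.
Proof. by rewrite /quad; ring. Qed.

Lemma shift_norm (v y A : R) (n : int) : `|y / v| <= A ->
  `|n|%N%:R - A <= `|Defs.shift v y n|.
Proof.
move=> h; rewrite lerBlDr; have -> : `|n|%N%:R = `|n%:~R : R|.
  by rewrite -intr_norm -abszE.
have -> : n%:~R = Defs.shift v y n - y / v by rewrite /Defs.shift addrK.
by rewrite (le_trans (ler_normB _ _)) // lerD2l.
Qed.

(** The majorant depends on the [z]'s only through the bound [A], so it serves all small [eps]
    simultaneously. *)
Lemma g4_dominate (tau : C) (d A : R) : 0 < complex.Im tau -> 0 < d ->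
  let v := complex.Im tau in
  exists2 M : int * int * int -> R, bounded_sums M &
  forall (z1 z2 z3 : C) (n1 n2 n3 : int),
    let s1 := Defs.shift v (complex.Im z1) n1 in
    let s2 := Defs.shift v (complex.Im z2) n2 in
    let s3 := Defs.shift v (complex.Im z3) n3 in
    `|complex.Im z1 / v| <= A -> `|complex.Im z2 / v| <= A -> `|complex.Im z3 / v| <= A ->
    far d s1 s2 s3 || far d (- s1) (- s2) (- s3) ->
    normc (g4_term z1 z2 z3 tau (n1, n2, n3)) <= M (n1, n2, n3).
Proof.
move=> v0 d0 v; have p0 := pi_gt0 R.
pose rho := expR (- (pi * v * d)) : R.
(* One summand bounds [quad (y / v)] by [3 A^2]; the other pays for [|s| >= |n| - A] in three
   coordinates. *)
pose K := expR (2%:R * pi * v * (3%:R * A * A) + pi * v * d * (3%:R * A)).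
have rho01 : 0 <= rho < 1 by rewrite expR_ge0 expR_lt1 oppr_lt0 !mulr_gt0.
have G := bounded_sums_geo rho01.
exists (fun n : int * int * int =>
    K * (rho ^+ `|n.1.1|%N * rho ^+ `|n.1.2|%N * rho ^+ `|n.2|%N)).
  apply: bounded_sumsZ; first exact: expR_ge0.
  exact: bounded_sumsM (bounded_sumsM G G) G.
move=> z1 z2 z3 n1 n2 n3 s1 s2 s3 h1 h2 h3 hf /=.
rewrite normc_g4_term // -/v -/s1 -/s2 -/s3 /rho -!expRM_natl -!expRD ler_expR.
have q : d / 2 * (`|s1| + `|s2| + `|s3|) <= quad s1 s2 s3.
  have /orP[|] := hf; first exact: quad_far.
  by move/(quad_far d0); rewrite !normrN quadN.
have A0 : 0 <= A := le_trans (normr_ge0 _) h1.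
have q0 : quad (complex.Im z1 / v) (complex.Im z2 / v) (complex.Im z3 / v) <= 3%:R * A * A.
  rewrite /quad; set x := _ / v; set y := _ / v; set z := _ / v.
  have : x * y <= A * A.
    by rewrite (le_trans (ler_norm _)) // normrM ler_pM.
  by have := sqr_ge0 z; lra.
have k1 := shift_norm n1 h1; have k2 := shift_norm n2 h2; have k3 := shift_norm n3 h3.
rewrite -/s1 -/s2 -/s3 in k1 k2 k3.
set N1 := `|n1|%N%:R : R in k1 *; set N2 := `|n2|%N%:R : R in k2 *.
set N3 := `|n3|%N%:R : R in k3 *.
have pv : 0 < pi * v by rewrite mulr_gt0.
have pvd : 0 < pi * v * d by rewrite mulr_gt0.
have t1 : 2 * (pi * v) * quad (complex.Im z1 / v) (complex.Im z2 / v) (complex.Im z3 / v) <=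
   2 * (pi * v) * (3%:R * A * A) by rewrite ler_wpM2l // mulr_ge0 // ltW.
have t2 : 2 * (pi * v) * (d / 2 * (`|s1| + `|s2| + `|s3|)) <= 2 * (pi * v) * quad s1 s2 s3.
  by rewrite ler_wpM2l // mulr_ge0 // ltW.
have t3 : pi * v * d * (N1 + N2 + N3 - 3 * A) <= pi * v * d * (`|s1| + `|s2| + `|s3|).
  by rewrite ler_wpM2l ?(ltW pvd) //; lra.
lra.
Qed.

Lemma g4_term_shift (tau z1 z2 z3 : C) (w1 w2 w3 e : R) (n1 n2 n3 : int) :
  g4_term (z1 + 'i%C * (w1 * e)%:C) (z2 + 'i%C * (w2 * e)%:C) (z3 + 'i%C * (w3 * e)%:C)
    tau (n1, n2, n3) =
  (expR (- (6%:R * pi) * (n2%:~R * w1 + n1%:~R * w2 - n3%:~R * w3) * e))%:C *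
  g4_term z1 z2 z3 tau (n1, n2, n3).
Proof.
have H (w : R) : zeta ('i%C * (w * e)%:C) = (expR (- (2%:R * pi) * w * e))%:C.
  rewrite /zeta /e2pi /cexp.
  have -> : 2%:R * pi%:C * 'i%C * ('i%C * (w * e)%:C) = (- (2%:R * pi) * w * e)%:C :> C.
    have ii : 'i%C * 'i%C = -1 :> C by have := sqr_i R; rewrite expr2.
    rewrite -mulrA [X in _ * X]mulrA ii !rmorphM !rmorphN !rmorphM rmorph_nat /=.
    by ring.
  by rewrite [complex.Im _]/= cos0 sin0; exact: mulr1.
have P (x : R) (m : int) : (x%:C : C) ^ m = (x ^ m)%:C.
  by case: m => m; rewrite /exprz ?fmorphV rmorphXn.
have HX (z : C) (w : R) (m : int) : zeta (z + 'i%C * (w * e)%:C) ^ m =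
    zeta z ^ m * (expR (m%:~R * (- (2%:R * pi) * w * e)))%:C.
  by rewrite [X in X ^ _]e2piD expfzMl -!/(zeta _) H P expRXz.
transitivity (qpow tau (3%:R * n1%:~R * n2%:~R - 3%:R * n3%:~R ^+ 2 / 2%:R) *
  (zeta z1 ^ (3 * n2) * (expR ((3 * n2)%:~R * (- (2%:R * pi) * w1 * e)))%:C) *
  (zeta z2 ^ (3 * n1) * (expR ((3 * n1)%:~R * (- (2%:R * pi) * w2 * e)))%:C) *
  (zeta z3 ^ (- (3 * n3)) * (expR ((- (3 * n3))%:~R * (- (2%:R * pi) * w3 * e)))%:C)).
  by rewrite /g4_term; congr (_ * _ * _ * _); apply: HX.
rewrite /g4_term.
rewrite (_ : - (6%:R * pi) * _ * e = (3 * n2)%:~R * (- (2%:R * pi) * w1 * e) +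
  (3 * n1)%:~R * (- (2%:R * pi) * w2 * e) +
  (- (3 * n3))%:~R * (- (2%:R * pi) * w3 * e)); last first.
  by rewrite !(intrM, intrN); ring.
rewrite !expRD !rmorphM /=.
move: (expR _)%:C (expR _)%:C (expR _)%:C (qpow _ _) (_ ^ _) (_ ^ _) (_ ^ _).
by move=> x1 x2 x3 x4 x5 x6 x7; ring.
Qed.

Lemma tends_expR (c : R) : tends (0 : R)^'+ (fun e => (expR (c * e))%:C) 1.
Proof.
have K : (expR (c * e) @[e --> (0 : R)] --> expR (c * 0)).
  apply: (@cvg_comp _ _ _ (fun e : R => c * e) expR); last exact: continuous_expR.
  exact: mulrl_continuous.
move/cvg_at_right_filter : K; rewrite mulr0 expR0 => K e e0.
move/cvgrPdist_lt : K => /(_ e e0); apply: filterS => t.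
by rewrite -normrN opprB -(rmorph1 (real_complex R)) -rmorphB normc_real.
Qed.

(** Common frame for all one-sided limits: once the region conditions are frozen as [P1] and [P3]
    for small [e], and these stay [d] away from the axes, dominated convergence applies. In each use
    one [w] is [1] or [-1] and the others are [0]. *)
Lemma g4_tends (tau z1 z2 z3 : C) (w1 w2 w3 d : R) (f1 f2 f3 : R -> C)
    (P1 P3 : int * int * int -> bool) (v := complex.Im tau) :
  0 < v -> 0 < d ->
  (forall e, f1 e = z1 + 'i%C * (w1 * e)%:C) ->
  (forall e, f2 e = z2 + 'i%C * (w2 * e)%:C) ->
  (forall e, f3 e = z3 + 'i%C * (w3 * e)%:C) ->
  (\forall e \near (0 : R)^'+, forall n1 n2 n3 : int,
    let s1 := Defs.shift v (complex.Im z1 + w1 * e) n1 in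
    let s2 := Defs.shift v (complex.Im z2 + w2 * e) n2 in
    let s3 := Defs.shift v (complex.Im z3 + w3 * e) n3 in
    [/\ S1 s1 s2 s3 = P1 (n1, n2, n3), S3 (- s1) (- s2) (- s3) = P3 (n1, n2, n3),
       P1 (n1, n2, n3) -> d <= s1 /\ d <= s2 &
       P3 (n1, n2, n3) -> d <= - s1 /\ d <= - s2]) ->
  exists2 L, tends (0 : R)^'+ (fun e => g4 (f1 e) (f2 e) (f3 e) tau) L &
    has_csum (fun n => ((P1 n)%:R + (P3 n)%:R) * g4_term z1 z2 z3 tau n) L.
Proof.
move=> v0 d0 F1 F2 F3 HP.
(* Bounds every perturbed [y / v] as long as [0 < e < 1]. *)
pose A : R := `|complex.Im z1 / v| + `|complex.Im z2 / v| + `|complex.Im z3 / v| +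
  (`|w1| + `|w2| + `|w3|) / v.
have [M FM HM] := g4_dominate A v0 d0.
have ImE (z : C) (w e : R) : complex.Im (z + 'i%C * (w * e)%:C) = complex.Im z + w * e.
  by case: z => a b /=; ring.
pose fe (P : int * int * int -> bool) (e : R) (n : int * int * int) : C :=
  if P n then g4_term (f1 e) (f2 e) (f3 e) tau n else 0.
pose g (P : int * int * int -> bool) (n : int * int * int) : C :=
  if P n then g4_term z1 z2 z3 tau n else 0.
have M0 := FM.1.
have bound (x w e : R) : 0 <= w -> 0 < e -> e < 1 ->
    `|x / v| + w / v <= A -> forall w', `|w'| <= w -> `|(x + w' * e) / v| <= A.
  move=> w0 e0 e1 h w' hw; apply: le_trans h.
  rewrite mulrDl (le_trans (ler_normD _ _)) // lerD2l !normrM.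
  rewrite (gtr0_norm (x := v^-1)) ?invr_gt0 //.
  rewrite ler_wpM2r ?invr_ge0 ?(ltW v0) // (gtr0_norm e0).
  by rewrite (le_trans _ hw) // ler_piMr // ltW.
have near1 : \forall e \near (0 : R)^'+, 0 < e < 1.
  near=> e; apply/andP; split; [near: e; exact: nbhs_right_gt | near: e; exact: nbhs_right_lt].
have dom P : (P = P1 \/ P = P3) ->
    \forall e \near (0 : R)^'+, forall n, normc (fe P e n) <= M n.
  move=> PE; apply: filterS2 near1 HP => e /andP[e0 e1] H [[n1 n2] n3].
  rewrite /fe; case: ifP => [Pn|_]; last by rewrite normc0.
  have [h1 h2 h3 h4] := H n1 n2 n3.
  have k0 (w : R) : 0 <= `|w| / v by rewrite divr_ge0 // ltW.
  apply: HM; rewrite ?F1 ?F2 ?F3 !ImE.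
  - apply: (bound _ `|w1|) => //; rewrite /A !mulrDl.
    by have := k0 w2; have := k0 w3; have := normr_ge0 (complex.Im z2 / v);
       have := normr_ge0 (complex.Im z3 / v); lra.
  - apply: (bound _ `|w2|) => //; rewrite /A !mulrDl.
    by have := k0 w1; have := k0 w3; have := normr_ge0 (complex.Im z1 / v);
       have := normr_ge0 (complex.Im z3 / v); lra.
  - apply: (bound _ `|w3|) => //; rewrite /A !mulrDl.
    by have := k0 w1; have := k0 w2; have := normr_ge0 (complex.Im z1 / v);
       have := normr_ge0 (complex.Im z2 / v); lra.
  case: PE => PE; rewrite PE in Pn; apply/orP; [left|right]; rewrite /far.
    by have [-> ->] := h3 Pn; rewrite h1 Pn.
  have [-> ->] := h4 Pn; move: Pn; rewrite -h2 !andbT.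
  by case/and3P => /ltW a1 /ltW a2 /ltW a3; rewrite /S1 a1 a2 a3.
have lim P n : tends (0 : R)^'+ (fun e => fe P e n) (g P n).
  rewrite /fe /g; case: (P n); last exact: tends_cst.
  case: n => [[n1 n2] n3]; set c := - (6%:R * pi) * (n2%:~R * w1 + n1%:~R * w2 - n3%:~R * w3).
  rewrite -[X in tends _ _ X]mul1r.
  apply: tends_eq (tendsM (tends_expR c) (tends_cst (g4_term z1 z2 z3 tau (n1, n2, n3)))).
  by apply: nearW => e; rewrite F1 F2 F3 g4_term_shift.
have gM P : (P = P1 \/ P = P3) -> forall n, normc (g P n) <= M n.
  move=> PE n; apply: (tends_le (lim P n)).
  by apply: filterS (dom P PE) => e.
exists (csum (g P1) + csum (g P3)).
  apply: tends_eq (tendsD (tends_csum FM (dom P1 (or_introl erefl)) (lim P1))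
    (tends_csum FM (dom P3 (or_intror erefl)) (lim P3))).
  apply: filterS HP => e H; rewrite /g4 /csum_on; congr (_ + _); congr csum;
    apply/funext => -[[n1 n2] n3]; have [h1 h2 _ _] := H n1 n2 n3;
    by rewrite /fe F1 F2 F3 !ImE -/v ?h1 ?h2.
have := has_csumD (csumP FM (gM P1 (or_introl erefl))) (csumP FM (gM P3 (or_intror erefl))).
apply: has_csum_eq => n; rewrite /g.
by case: (P1 n); case: (P3 n); rewrite /= ?mulr1n ?mulr0n; ring.
Unshelve. all: by end_near.
Qed.
End Jumps.

(** * Distances to the integers, geometric series over half-lines, symmetry of [g4] *)

Section Regions.
Variable R : realType.
Local Notation C := R[i].

Lemma inZv_gap (v y : R) : 0 < v -> ~ inZv v y ->
  exists2 d : R, 0 < d & forall n : int, d <= `|Defs.shift v y n|.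
Proof.
move=> v0 ny; set x := y / v; pose f := Num.floor x; pose t := x - f%:~R.
have /andP[fx xf] : f%:~R <= x < (f + 1)%:~R by rewrite floor_itv.
have t0 : 0 < t.
  rewrite subr_gt0 lt_neqAle fx andbT; apply/eqP => E; apply: ny; exists f.
  by rewrite E /x mulfVK ?gt_eqF.
have t1 : t < 1 by move: xf; rewrite intrD /t; lra.
exists (Num.min t (1 - t)) => [|n]; first by rewrite lt_min t0 subr_gt0.
have -> : Defs.shift v y n = (n + f)%:~R + t by rewrite /Defs.shift -/x intrD /t; ring.
rewrite ge_min; have [m0|m0] := leP 0 (n + f).
  have : 0 <= (n + f)%:~R :> R by rewrite ler0z.
  by move=> h; rewrite ger0_norm ?lerDr ?h //; lra.
have : (n + f)%:~R <= (-1)%:~R :> R by rewrite ler_int; lia.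
by rewrite intrN => h; rewrite ltr0_norm; lra.
Qed.

(** The source of the jump: only [N = 0] feels the sign of a small perturbation. *)
Lemma int_perturb_ge0 (N : int) (t : R) (b : bool) :
  (if b then 0 < t < 1 else -1 < t < 0) ->
  (0 <= N%:~R + t) = (if b then 0 <= N else 0 < N).
Proof.
case: b => /andP[t0 t1].
  have [N0|N0] := leP 0 N.
    have : 0 <= N%:~R :> R by rewrite ler0z.
    lra.
  have : N%:~R <= (-1)%:~R :> R by rewrite ler_int; lia.
  by rewrite intrN => h; apply/negbTE; rewrite -ltNge; lra.
have [N0|N0] := ltP 0 N.
  have : 1%:~R <= N%:~R :> R by rewrite ler_int; lia.
  lra.
have : N%:~R <= 0 :> R by rewrite lerz0.
by move=> h; apply/negbTE; rewrite -ltNge; lra.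
Qed.

Lemma has_csum_geo_ge (x : C) (c : int) : x != 0 -> normc x < 1 ->
  has_csum (fun n : int => if c <= n then x ^ n else 0) (x ^ c / (1 - x)).
Proof.
move=> x0 x1.
have x01 : 0 <= normc x < 1 by rewrite normc_ge0 x1.
have nx : 1 - x != 0.
  by rewrite subr_eq0; apply: contraTneq x1 => <-; rewrite normc1 ltxx.
pose f (n : int) : C := if 0 <= n then x ^ n else 0.
have fM n : normc (f n) <= normc x ^+ `|n|%N.
  rewrite /f; case: n => n; first by rewrite normcXz.
  by rewrite normc0 exprn_ge0 ?normc_ge0.
have Hf := csumP (bounded_sums_geo x01) fM.
have bP (a : int) : bijective (fun m : int => m - a).
  by exists (fun m : int => m + a) => m; ring.
have E : csum f = (1 - x)^-1.
  (* [f] minus [x] times its translate is supported at [0], which determines the sum. *)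
  have := has_csumB Hf (has_csumZ x (has_csum_reindex (bP 1) Hf)).
  have : has_csum (fun n => f n - x * (f \o (fun m => m - 1)) n) 1.
    rewrite [X in has_csum _ X](_ : 1 = f 0 - x * (f \o (fun m => m - 1)) 0).
      apply: (@has_csum_delta _ _ 0 (fun n => f n - x * (f \o (fun m => m - 1)) n)) => n n0.
      rewrite /f /=; case: ifP => h; last first.
        by rewrite ifF ?mulr0 ?subrr //; lia.
      rewrite ifT; last by lia.
      rewrite expfzDr // -invr_expz expr1z mulrCA mulfV // mulr1 subrr //.
    by rewrite /f /= mulr0 subr0.
  move=> h1 h2; have := has_csum_unique h1 h2.
  rewrite -{1}[csum f]mul1r -mulrBl => h.
  by apply: (mulfI nx); rewrite -h mulfV.
rewrite -E; apply: has_csum_eq (has_csumZ (x ^ c) (has_csum_reindex (bP c) Hf)) => n.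
rewrite /f /= subr_ge0; case: ifP => _; last by rewrite mulr0.
by rewrite -expfzDr // addrC subrK.
Qed.

(** The expansion at infinity of the rational function that [has_csum_geo_ge] expands at [0]; its
    minus sign matches the one attached to the negative quadrant in the slice. *)
Lemma has_csum_geo_lt (x : C) (c : int) : 1 < normc x ->
  has_csum (fun n : int => if n < c then - x ^ n else 0) (x ^ c / (1 - x)).
Proof.
move=> x1; have x0 : x != 0 by rewrite -normc_gt0 (lt_trans ltr01).
have nx : 1 - x != 0.
  by rewrite subr_eq0; apply: contraTneq x1 => <-; rewrite normc1 ltxx.
have V1 : normc x^-1 < 1 by rewrite normcV invf_lt1 // (lt_trans ltr01).
have V0 : x^-1 != 0 by rewrite invr_eq0.
have bN : bijective (fun m : int => - m) by exists (fun m : int => - m) => m; rewrite opprK.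
have := has_csumZ (-1) (has_csum_reindex bN (has_csum_geo_ge (1 - c) V0 V1)).
have -> : -1 * (x^-1 ^ (1 - c) / (1 - x^-1)) = x ^ c / (1 - x).
  rewrite expfzDr // expr1z exprz_inv opprK.
  have nx' : x - 1 != 0 by rewrite subr_eq0 eq_sym -subr_eq0.
  by move: (x ^ c) => y; field; rewrite x0 nx nx'.
apply: has_csum_eq => n /=.
have -> : (1 - c <= - n) = (n < c) by lia.
by case: ifP => _; rewrite ?mulr0 // exprz_inv opprK mulN1r.
Qed.

(* No summability is assumed: without it both sides are the same default value
   of [lim]. *)
Lemma csum_reindexE (I J : choiceType) (h : I -> J) (f : J -> C) :
  bijective h -> csum (f \o h) = csum f.
Proof.
move=> bh; rewrite /csum /sum.
have K (I' : choiceType) (g : I' -> C) (l : C) :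
    (partial_sum (R := C^o) g @ @totally I' --> (l : C^o)) <-> has_csum g l.
  have e : (fun A : {fset I'} => \sum_(i <- A) g i) = partial_sum (R := C^o) g.
    by apply/funext => A; rewrite /partial_sum big_seq_fsetE.
  rewrite /has_csum e; split=> h'; first exact/tends_cvg.
  by move/tends_cvg: h'.
have [k hk kh] := bh.
rewrite /lim /lim_in; congr (xget _ _); apply/predeqP => l; rewrite /=.
split=> [/K H|/K H]; apply/K; last exact: has_csum_reindex.
have bk : bijective k by exists h.
apply: has_csum_eq (has_csum_reindex bk H) => j /=.
by rewrite kh.
Qed.

(** Exchanging [n1] and [n2] exchanges [z1] and [z2]; this reduces part (3) to part (2). *)
Lemma g4_swap (z1 z2 z3 tau : C) : g4 z1 z2 z3 tau = g4 z2 z1 z3 tau.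
Proof.
rewrite /g4 /csum_on.
have bs : bijective (fun n : int * int * int => (n.1.2, n.1.1, n.2)).
  by exists (fun n : int * int * int => (n.1.2, n.1.1, n.2)) => -[[? ?] ?].
have T n1 n2 n3 : g4_term z1 z2 z3 tau (n1, n2, n3) = g4_term z2 z1 z3 tau (n2, n1, n3).
  rewrite /g4_term; congr (_ * _); rewrite -[LHS]mulrA -[RHS]mulrA [X in _ = _ * X]mulrC.
  by congr (qpow _ _ * _); ring.
have E (f g : int * int * int -> C) :
    (forall n1 n2 n3, f (n1, n2, n3) = g (n2, n1, n3)) -> csum f = csum g.
  move=> fg; rewrite -(csum_reindexE g bs); congr csum.
  by apply/funext => -[[n1 n2] n3]; apply: fg.
apply: (f_equal2 +%R); apply: E => n1 n2 n3; cbv beta iota; rewrite T.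
  by rewrite /S1 andbCA.
by rewrite /S3 andbCA.
Qed.

Lemma g4_termE (z1 z2 z3 tau : C) (n1 n2 n3 : int) :
  g4_term z1 z2 z3 tau (n1, n2, n3) =
  e2pi ((3%:R * n1%:~R * n2%:~R - 3%:R / 2%:R * n3%:~R ^+ 2) * tau +
    3%:R * n2%:~R * z1 + 3%:R * n1%:~R * z2 - 3%:R * n3%:~R * z3).
Proof.
rewrite /g4_term /zeta -!e2piZ /qpow -!e2piD; congr e2pi.
rewrite !(rmorphB, rmorphM, rmorphXn, fmorphV, rmorph_int, rmorph_nat) /=.
by rewrite mulrNz !intrM; field.
Qed.
End Regions.

(** * One-sided limits of [g4] and their differences *)

Section Final.
Variable R : realType.
Local Notation C := R[i].

Lemma near_right_lt (x : R) : 0 < x -> \forall e \near (0 : R)^'+, 0 < e < x.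
Proof.
move=> x0; near=> e; apply/andP; split; near: e.
  exact: nbhs_right_gt.
exact: nbhs_right_lt.
Unshelve. all: by end_near.
Qed.

Lemma inZv_gap_sub (v x y : R) : 0 < v -> ~ inZv v (x - y) -> exists2 d : R, 0 < d &
  forall m n : int, d <= `|Defs.shift v x m - Defs.shift v y n|.
Proof.
move=> v0 /(inZv_gap v0)[d d0 H]; exists d => // m n.
have -> : Defs.shift v x m - Defs.shift v y n = Defs.shift v (x - y) (m - n).
  by rewrite /Defs.shift intrB mulrBl; ring.
exact: H.
Qed.

Lemma le_perturb (a b d t : R) : d <= `|a - b| -> `|t| < d -> (a + t <= b) = (a <= b).
Proof.
move=> h1; rewrite ltr_norml => /andP[h2 h3].
have [h|h] := leP a b.
  by move: h1; rewrite ler0_norm ?subr_le0 //; lra.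
move: h1; rewrite gtr0_norm ?subr_gt0 // => h1.
by apply/negbTE; rewrite -ltNge; lra.
Qed.

Section Sides.
Variables (tau z1 z2 z3 : C) (k : int).
Local Notation v := (complex.Im tau).
Local Notation y1 := (complex.Im z1).
Local Notation y2 := (complex.Im z2).
Local Notation y3 := (complex.Im z3).
Hypothesis v0 : 0 < v.

(** The truth value of [0 <= N + t] for [t] infinitesimal, positive if [b] and negative
    otherwise. *)
Let nonneg (b : bool) (N : int) := if b then 0 <= N else 0 < N.

(** Comparisons of [s3] with [s1] and [s2] survive a small shift because of their gaps; only the
    sign of [s3], an integer plus [t], depends on the side. As [y3] lies in [Zv], neither [y1] nor
    [y2] does, which yields [d]. *)
Lemma g4_side3 (b : bool) (f3 : R -> C) : y3 = k%:~R * v ->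
  ~ inZv v (y1 - y3) -> ~ inZv v (y2 - y3) ->
  (forall e, f3 e = z3 + 'i%C * ((if b then 1 else -1) * e)%:C) ->
  exists2 L, tends (0 : R)^'+ (fun e => g4 z1 z2 (f3 e) tau) L &
    has_csum (fun n : int * int * int =>
      (([&& Defs.shift v y3 n.2 <= Defs.shift v y1 n.1.1,
           Defs.shift v y3 n.2 <= Defs.shift v y2 n.1.2 & nonneg b (n.2 + k)])%:R +
       ([&& Defs.shift v y1 n.1.1 < Defs.shift v y3 n.2,
           Defs.shift v y2 n.1.2 < Defs.shift v y3 n.2 & ~~ nonneg b (n.2 + k)])%:R) *
      g4_term z1 z2 z3 tau n) L.
Proof.
move=> y3E h1 h2 F3; set w : R := if b then 1 else -1.
have s3E n : Defs.shift v y3 n = (n + k)%:~R.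
  by rewrite /Defs.shift y3E mulfK ?gt_eqF // intrD.
have ny (x : R) : ~ inZv v (x - y3) -> ~ inZv v x.
  by move=> nx [m xE]; apply: nx; exists (m - k); rewrite xE y3E intrB; ring.
have [d1 d10 D1] := inZv_gap v0 (ny _ h1); have [d2 d20 D2] := inZv_gap v0 (ny _ h2).
have [e1 e10 E1] := inZv_gap_sub v0 h1; have [e2 e20 E2] := inZv_gap_sub v0 h2.
pose d := Num.min d1 d2; have d0 : 0 < d by rewrite lt_min d10.
(* The bound [1] settles the sign of an integer plus [t]; [e1] and [e2] preserve the two
   comparisons. *)
pose c := Num.min 1 (Num.min e1 e2); have c0 : 0 < c by rewrite !lt_min ltr01 e10.
apply: (@g4_tends _ tau z1 z2 z3 0 0 w d (fun=> z1) (fun=> z2) f3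
  (fun n => [&& Defs.shift v y3 n.2 <= Defs.shift v y1 n.1.1,
           Defs.shift v y3 n.2 <= Defs.shift v y2 n.1.2 & nonneg b (n.2 + k)])
  (fun n => [&& Defs.shift v y1 n.1.1 < Defs.shift v y3 n.2,
           Defs.shift v y2 n.1.2 < Defs.shift v y3 n.2 & ~~ nonneg b (n.2 + k)]) v0 d0) => //.
- by move=> e; rewrite mul0r rmorph0 mulr0 addr0.
- by move=> e; rewrite mul0r rmorph0 mulr0 addr0.
have cv : 0 < c * v by rewrite mulr_gt0.
apply: filterS (near_right_lt cv) => e /andP[ep ec] n1 n2 n3.
set s1 := Defs.shift v (y1 + 0 * e) n1; set s2 := Defs.shift v (y2 + 0 * e) n2.
set s3 := Defs.shift v (y3 + w * e) n3.
pose t := w * e / v.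
have ev0 : 0 < e / v by rewrite divr_gt0.
have evc : e / v < c by rewrite ltr_pdivrMr.
have tE : t = if b then e / v else - (e / v) by rewrite /t /w; case: (b); ring.
have [c1 c2 c3] : [/\ c <= 1, c <= e1 & c <= e2] by rewrite /c !ge_min !lexx !orbT.
have tn : `|t| = e / v by rewrite tE; case: (b); rewrite ?normrN gtr0_norm.
have s3t : s3 = Defs.shift v y3 n3 + t by rewrite /s3 /Defs.shift /t; ring.
have s1t : s1 = Defs.shift v y1 n1 by rewrite /s1 mul0r addr0.
have s2t : s2 = Defs.shift v y2 n2 by rewrite /s2 mul0r addr0.
have q1 : (s3 <= s1) = (Defs.shift v y3 n3 <= s1).
  by rewrite s3t; apply: (@le_perturb _ _ e1); rewrite ?tn ?(lt_le_trans evc) // distrC s1t.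
have q2 : (s3 <= s2) = (Defs.shift v y3 n3 <= s2).
  by rewrite s3t; apply: (@le_perturb _ _ e2); rewrite ?tn ?(lt_le_trans evc) // distrC s2t.
have q3 : (0 <= s3) = nonneg b (n3 + k).
  rewrite s3t s3E; apply: int_perturb_ge0; rewrite tE; case: (b).
    by rewrite ev0 (lt_le_trans evc).
  by rewrite ltrN2 oppr_lt0 ev0 (lt_le_trans evc).
have p1 : d <= `|s1| by rewrite s1t (le_trans _ (D1 n1)) // ge_min lexx.
have p2 : d <= `|s2| by rewrite s2t (le_trans _ (D2 n2)) // ge_min lexx orbT.
rewrite /= -s1t -s2t /S1 /S3 !ltrN2 oppr_gt0 q1 q2 q3 !ltNge q1 q2 q3; split=> //.
  move=> /and3P[a1 a2 a3].
  have N0 : 0 <= Defs.shift v y3 n3.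
    by rewrite s3E ler0z; move: a3; rewrite /nonneg; case: (b) => // /ltW.
  by move: p1 p2; rewrite !ger0_norm // (le_trans N0).
move=> /and3P[a1 a2 a3].
have N0 : Defs.shift v y3 n3 <= 0.
  rewrite s3E lerz0; move: a3; rewrite /nonneg; case: (b); rewrite -?ltNge -?leNgt //.
  exact: ltW.
rewrite -!ltNge in a1 a2.
by move: p1 p2; rewrite !ltr0_norm // (lt_le_trans _ N0).
Qed.

(** Now [s1 - s3] is an integer plus [t], and [d] comes from [s3] alone: in either region [s1] and
    [s2] lie beyond [s3], on the same side of [0]. *)
Lemma g4_side1 (b : bool) (f1 : R -> C) : y1 - y3 = k%:~R * v ->
  ~ inZv v y3 -> ~ inZv v (y2 - y3) ->
  (forall e, f1 e = z1 + 'i%C * ((if b then 1 else -1) * e)%:C) ->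
  exists2 L, tends (0 : R)^'+ (fun e => g4 (f1 e) z2 z3 tau) L &
    has_csum (fun n : int * int * int =>
      (([&& nonneg b (n.1.1 + k - n.2), Defs.shift v y3 n.2 <= Defs.shift v y2 n.1.2 &
          0 <= Defs.shift v y3 n.2])%:R +
       ([&& ~~ nonneg b (n.1.1 + k - n.2), Defs.shift v y2 n.1.2 < Defs.shift v y3 n.2 &
          Defs.shift v y3 n.2 < 0])%:R) *
      g4_term z1 z2 z3 tau n) L.
Proof.
move=> y1E h1 h2 F1; set w : R := if b then 1 else -1.
have s1E n m : Defs.shift v y1 n = Defs.shift v y3 m + (n + k - m)%:~R.
  rewrite /Defs.shift (_ : y1 = y3 + k%:~R * v); last by rewrite -y1E; ring.
  by rewrite mulrDl mulfK ?gt_eqF // intrB intrD; ring.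
have [d d0 D] := inZv_gap v0 h1.
apply: (@g4_tends _ tau z1 z2 z3 w 0 0 d f1 (fun=> z2) (fun=> z3)
  (fun n => [&& nonneg b (n.1.1 + k - n.2), Defs.shift v y3 n.2 <= Defs.shift v y2 n.1.2 &
          0 <= Defs.shift v y3 n.2])
  (fun n => [&& ~~ nonneg b (n.1.1 + k - n.2), Defs.shift v y2 n.1.2 < Defs.shift v y3 n.2 &
          Defs.shift v y3 n.2 < 0]) v0 d0) => //.
- by move=> e; rewrite mul0r rmorph0 mulr0 addr0.
- by move=> e; rewrite mul0r rmorph0 mulr0 addr0.
apply: filterS (near_right_lt v0) => e /andP[ep ec] n1 n2 n3.
set s1 := Defs.shift v (y1 + w * e) n1; set s2 := Defs.shift v (y2 + 0 * e) n2.
set s3 := Defs.shift v (y3 + 0 * e) n3.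
pose t := w * e / v.
have ev0 : 0 < e / v by rewrite divr_gt0.
have evc : e / v < 1 by rewrite ltr_pdivrMr // mul1r.
have tE : t = if b then e / v else - (e / v) by rewrite /t /w; case: (b); ring.
have s3t : s3 = Defs.shift v y3 n3 by rewrite /s3 mul0r addr0.
have s2t : s2 = Defs.shift v y2 n2 by rewrite /s2 mul0r addr0.
have s1t : s1 = s3 + ((n1 + k - n3)%:~R + t).
  have -> : s1 = Defs.shift v y1 n1 + t by rewrite /s1 /Defs.shift /t; ring.
  by rewrite (s1E n1 n3) s3t addrA.
have q1 : (s3 <= s1) = nonneg b (n1 + k - n3).
  rewrite s1t lerDl; apply: int_perturb_ge0; rewrite tE; case: (b); first by rewrite ev0.
  by rewrite ltrN2 oppr_lt0 ev0 evc.
have p3 : d <= `|s3| by rewrite s3t.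
rewrite /= -s2t -s3t /S1 /S3 !ltrN2 oppr_gt0 -q1 -ltNge; split=> //.
  move=> /and3P[a1 a2 a3]; rewrite ger0_norm // in p3.
  by split; apply: le_trans p3 _.
move=> /and3P[a1 a2 a3]; rewrite ltr0_norm // in p3.
by split; apply: (le_trans p3); rewrite lerN2 ltW.
Qed.

Lemma g4_jump3 : y3 = k%:~R * v ->
  ~ inZv v (y1 - y3) -> ~ inZv v (y2 - y3) ->
  exists2 L, tends (0 : R)^'+ (fun e : R =>
      g4 z1 z2 (z3 + 'i%C * e%:C) tau - g4 z1 z2 (z3 - 'i%C * e%:C) tau) L &
    has_csum (fun n : int * int =>
      (((0 <= Defs.shift v y1 n.1) && (0 <= Defs.shift v y2 n.2))%:R -
       ((Defs.shift v y1 n.1 < 0) && (Defs.shift v y2 n.2 < 0))%:R) *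
      g4_term z1 z2 z3 tau (n.1, n.2, - k)) L.
Proof.
move=> h0 h1 h2.
have [|L1 T1 S1] := @g4_side3 true (fun e => z3 + 'i%C * e%:C) h0 h1 h2.
  by move=> e; rewrite mul1r.
have [|L2 T2 S2] := @g4_side3 false (fun e => z3 - 'i%C * e%:C) h0 h1 h2.
  by move=> e; rewrite mulN1r rmorphN mulrN.
exists (L1 - L2); first exact: tendsB.
apply: has_csum_Fubini (has_csumB S1 S2) _ => -[n1 n2] /=.
have s3E : Defs.shift v y3 (- k) = 0.
  by rewrite /Defs.shift h0 mulfK ?gt_eqF // -intrD addNr.
set F := (X in has_csum X).
rewrite [X in has_csum _ X](_ : _ = F (- k)).
  (* Off the slice [n3 + k] is nonzero, weak and strict signs agree, and the two one-sided weights
     cancel. *)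
  apply: has_csum_delta => n3 n3k; rewrite /F /nonneg /= -mulrBl.
  have -> : (0 < n3 + k) = (0 <= n3 + k).
    by rewrite lt_neqAle; case: eqVneq => // e; case/eqP: n3k; lia.
  by rewrite subrr mul0r.
(* On the slice the upper side keeps only the [S1] part and the lower side only the [-S3] part,
   whence the minus sign. *)
rewrite /F /nonneg /= s3E addNr lexx ltxx /= !andbF !andbT /= -mulrBl; congr (_ * _).
by rewrite addr0 add0r.
Qed.

Lemma g4_jump1 : y1 - y3 = k%:~R * v ->
  ~ inZv v y3 -> ~ inZv v (y2 - y3) ->
  exists2 L, tends (0 : R)^'+ (fun e : R =>
      g4 (z1 + 'i%C * e%:C) z2 z3 tau - g4 (z1 - 'i%C * e%:C) z2 z3 tau) L &
    has_csum (fun n : int * int =>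
      (((Defs.shift v y3 n.2 <= Defs.shift v y2 n.1) && (0 <= Defs.shift v y3 n.2))%:R -
       ((Defs.shift v y2 n.1 < Defs.shift v y3 n.2) && (Defs.shift v y3 n.2 < 0))%:R) *
      g4_term z1 z2 z3 tau (n.2 - k, n.1, n.2)) L.
Proof.
move=> h0 h1 h2.
have [|L1 T1 S1] := @g4_side1 true (fun e => z1 + 'i%C * e%:C) h0 h1 h2.
  by move=> e; rewrite mul1r.
have [|L2 T2 S2] := @g4_side1 false (fun e => z1 - 'i%C * e%:C) h0 h1 h2.
  by move=> e; rewrite mulN1r rmorphN mulrN.
exists (L1 - L2); first exact: tendsB.
(* Makes [n1], the variable pinned by the slice, the inner variable for Fubini. *)
have bij : bijective (fun n : int * int * int => (n.2, n.1.1, n.1.2)).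
  by exists (fun n : int * int * int => (n.1.2, n.2, n.1.1)) => -[[? ?] ?].
apply: has_csum_Fubini (has_csum_reindex bij (has_csumB S1 S2)) _ => -[n2 n3] /=.
set F := (X in has_csum X).
rewrite [X in has_csum _ X](_ : _ = F (n3 - k)).
  apply: has_csum_delta => n1 n1k; rewrite /F /nonneg /= -mulrBl.
  have -> : (0 < n1 + k - n3) = (0 <= n1 + k - n3).
    by rewrite lt_neqAle; case: eqVneq => // e; case/eqP: n1k; lia.
  by rewrite subrr mul0r.
rewrite /F /nonneg /= subrK subrr lexx ltxx /= -mulrBl; congr (_ * _).
by rewrite addr0 add0r.
Qed.
End Sides.
End Final.

(** * Evaluation of the slices *)
Section Evaluation.
Variable R : realType.
Local Notation C := R[i].

Lemma e2piB (z w : C) : e2pi (z - w) = e2pi z / e2pi w.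
Proof.
have w0 := e2pi_neq0 w.
by apply: (mulIf w0); rewrite mulfVK // -e2piD subrK.
Qed.

Lemma normc_zeta3 (z tau : C) (m : int) : let v := complex.Im tau in 0 < v ->
  normc (zeta z ^+ 3 * qpow tau 3%:R ^ m) =
  expR (- (2%:R * pi * 3%:R * v) * Defs.shift v (complex.Im z) m).
Proof.
move=> v v0; rewrite normcM normcX normcXz normc_qpow normc_e2pi expRXz -expRM_natl -expRD.
by congr expR; rewrite /Defs.shift -/v; field; rewrite gt_eqF.
Qed.

Lemma regular_zeta3 (z tau : C) : 0 < complex.Im tau ->
  ~ inZv (complex.Im tau) (complex.Im z) ->
  regular (qpow tau 3%:R) (zeta z ^+ 3).
Proof.
move=> v0 nz; apply: regular_normc => [|m]; first by rewrite expf_neq0 // e2pi_neq0.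
rewrite normc_zeta3 //; have [d d0 D] := inZv_gap v0 nz.
have sm : Defs.shift (complex.Im tau) (complex.Im z) m != 0.
  by rewrite -normr_gt0 (lt_le_trans d0).
rewrite -expR0 (inj_eq (@expR_inj R)) mulf_neq0 // oppr_eq0 gt_eqF //.
by rewrite !mulr_gt0 // pi_gt0.
Qed.

(** The right side is [b ^ n] times the value of a geometric series in [a Q^n] cut at [c]; the left
    side is a term of the Kronecker series at [b Q^c]. *)
Lemma kron_termE (Q a b : C) (n c : int) :
  a ^ c * ((b * Q ^ c) ^ n / (1 - a * Q ^ n)) =
  b ^ n * ((a * Q ^ n) ^ c / (1 - a * Q ^ n)).
Proof.
rewrite (expfzMl b) (expfzMl a) exprzAC; move: ((1 - _)^-1) => y.
by move: (a ^ c) (b ^ n) ((Q ^ n) ^ c) => x z t; ring.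
Qed.

(** Summing over [n2] for fixed [n1] gives a geometric series in [a Q^n1]; both signs of [s1] give
    the same rational function, so the outer sum is one Kronecker series. *)
Lemma kron_lattice (tau z1 z2 : C) (l P : C) : let v := complex.Im tau in
  let Q := qpow tau 3%:R in let a := zeta z1 ^+ 3 in let b := zeta z2 ^+ 3 in
  0 < v -> ~ inZv v (complex.Im z1) -> ~ inZv v (complex.Im z2) ->
  tends \oo (qpoch Q) P ->
  has_csum (fun n : int * int =>
      (((0 <= Defs.shift v (complex.Im z1) n.1) && (0 <= Defs.shift v (complex.Im z2) n.2))%:R -
       ((Defs.shift v (complex.Im z1) n.1 < 0) && (Defs.shift v (complex.Im z2) n.2 < 0))%:R) *
      (b ^ n.1 * (a * Q ^ n.1) ^ n.2)) l ->
  l = P ^+ 3 * jtheta Q (a * b) / (jtheta Q a * jtheta Q b).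
Proof.
move=> v Q a b v0 h1 h2 HP Hl; have p0 := pi_gt0 R.
have Q0 : Q != 0 := qpow_neq0 _ _.
have Q1 : normc Q < 1 by apply: normc_qpow_lt1.
have ra : regular Q a := regular_zeta3 v0 h1.
have rb : regular Q b := regular_zeta3 v0 h2.
have [a0 _] := ra; have [b0 _] := rb.
(* [c] is the least [n] with [n + y2 / v >= 0]. Hence [c + y2 / v] lies strictly between [0] and
   [1], which places [b Q^c] in the annulus. *)
set x := complex.Im z2 / v; pose c := - Num.floor x.
have /andP[fx xf] : (Num.floor x)%:~R <= x < (Num.floor x + 1)%:~R by rewrite floor_itv.
have s2E n : (0 <= Defs.shift v (complex.Im z2) n) = (c <= n).
  rewrite /Defs.shift -/x -lerBlDl sub0r -mulrNz -floor_ge_int /c.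
  by rewrite lerNl.
have hb : normc Q < normc (b * Q ^ c) < 1.
  rewrite normc_zeta3 // normc_qpow ltr_expR expR_lt1 -/v.
  have pv : 0 < 2%:R * pi * 3%:R * v by rewrite !mulr_gt0.
  have [d d0 D] := inZv_gap v0 h2.
  have t0 : 0 < Defs.shift v (complex.Im z2) c.
    rewrite lt_neqAle s2E lexx andbT eq_sym; have := D c.
    by case: eqVneq => // ->; rewrite normr0 leNgt d0.
  have t1 : Defs.shift v (complex.Im z2) c < 1.
    by move: xf; rewrite /Defs.shift -/x /c intrD intrN; lra.
  rewrite [X in _ && X](_ : _ = true) ?andbT; last by rewrite mulNr oppr_lt0 mulr_gt0.
  have -> : - (2 * pi) * (3 * v) = - (2%:R * pi * 3%:R * v) * 1 by ring.
  by rewrite ltr_nM2l // oppr_lt0.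
rewrite -(kronecker Q0 Q1 HP ra hb rb).
have [K [rho [K0 rho01 HK]]] := kron_dominate Q0 Q1 ra hb.
have HF := csumP (bounded_sumsZ K0 (bounded_sums_geo rho01)) HK.
apply: (has_csum_unique _ (has_csumZ (a ^ c) HF)).
apply: has_csum_Fubini Hl _ => n1 /=.
have xn : normc (a * Q ^ n1) =
    expR (- (2%:R * pi * 3%:R * v) * Defs.shift v (complex.Im z1) n1).
  exact: normc_zeta3.
have pv : 0 < 2%:R * pi * 3%:R * v by rewrite !mulr_gt0.
have aQ0 : a * Q ^ n1 != 0 by rewrite mulf_neq0 // expfz_neq0.
rewrite kron_termE.
(* The sign of [s1] decides whether [|a Q^n1|] is below or above [1], hence which expansion applies;
   [s1 = 0] is excluded. *)
have [s0|s0] := leP 0 (Defs.shift v (complex.Im z1) n1).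
  have spos : 0 < Defs.shift v (complex.Im z1) n1.
    have [d d0 D] := inZv_gap v0 h1; rewrite lt_neqAle s0 andbT eq_sym; have := D n1.
    by case: eqVneq => // ->; rewrite normr0 leNgt d0.
  have x1 : normc (a * Q ^ n1) < 1 by rewrite xn expR_lt1 mulNr oppr_lt0 mulr_gt0.
  apply: has_csum_eq (has_csumZ (b ^ n1) (has_csum_geo_ge c aQ0 x1)) => n2.
  rewrite s2E /= subr0; case: (c <= n2); first by rewrite mul1r.
  by rewrite mul0r mulr0.
have x1 : 1 < normc (a * Q ^ n1) by rewrite xn expR_gt1 mulNr -mulrN mulr_gt0 // oppr_gt0.
apply: has_csum_eq (has_csumZ (b ^ n1) (has_csum_geo_lt c x1)) => n2.
rewrite (_ : (Defs.shift v (complex.Im z2) n2 < 0) = (n2 < c)); last by rewrite !ltNge s2E.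
rewrite /= sub0r; case: (n2 < c); first by rewrite mulN1r mulrN.
by rewrite oppr0 mulr0 mul0r.
Qed.

(** [chi3] is the signed indicator of [0 < x2 < x1] and of its opposite. The descriptions differ on
    the boundary lines [x2 = 0] and [x1 = x2], hence the hypotheses. *)
Lemma chi3E (x1 x2 : R) : x2 != 0 -> x1 - x2 != 0 ->
  chi3 x1 x2 = ((0 <= x2) && (0 <= x1 - x2))%:R - ((x2 < 0) && (x1 - x2 < 0))%:R.
Proof.
move=> x20 x120; rewrite /chi3 /Defs.H /Hstar.
have [x2p|x2n|x2z] := ltgtP 0 x2; last by rewrite -x2z eqxx in x20.
  have [d|d|d] := ltgtP 0 (x1 - x2); last by rewrite -d eqxx in x120.
    have x1p : 0 < x1 by lra.
    by rewrite gtr0_sg // !gtr0_norm // d mulr_ge0 ?ltW //= mul1r subr0 mulr1.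
  rewrite /= subrr.
  have [x1p|x1n|x1z] := ltgtP 0 x1.
  - by rewrite !gtr0_norm // ltNge (ltW d) /= mulr0 mul0r.
  - by rewrite [0 <= x1 * x2]leNgt nmulr_rlt0 // x2p /= mulr0.
  - by rewrite -x1z sgr0 !mul0r.
have [d|d|d] := ltgtP 0 (x1 - x2); last by rewrite -d eqxx in x120.
  rewrite /= subrr.
  have [x1p|x1n|x1z] := ltgtP 0 x1.
  - by rewrite [0 <= x1 * x2]leNgt pmulr_rlt0 // x2n /= mulr0.
  - rewrite !ltr0_norm // (_ : - x1 - - x2 = - (x1 - x2)); last by ring.
    by rewrite oppr_gt0 ltNge (ltW d) /= mulr0 mul0r.
  - by rewrite -x1z sgr0 !mul0r.
have x1n : x1 < 0 by lra.
rewrite ltr0_sg // !ltr0_norm // (_ : - x1 - - x2 = - (x1 - x2)); last by ring.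
by rewrite oppr_gt0 d nmulr_rge0 // ltW //= sub0r !mulr1.
Qed.

Lemma f3_slice (tau z1 z2 z3 : C) (k : int) (l : C) : let v := complex.Im tau in
  0 < v -> complex.Im z1 - complex.Im z3 = k%:~R * v ->
  ~ inZv v (complex.Im z3) -> ~ inZv v (complex.Im z2 - complex.Im z3) ->
  has_csum (fun n : int * int =>
      (((Defs.shift v (complex.Im z3) n.2 <= Defs.shift v (complex.Im z2) n.1) &&
        (0 <= Defs.shift v (complex.Im z3) n.2))%:R -
       ((Defs.shift v (complex.Im z2) n.1 < Defs.shift v (complex.Im z3) n.2) &&
        (Defs.shift v (complex.Im z3) n.2 < 0))%:R) *
      g4_term z1 z2 z3 tau (n.2 - k, n.1, n.2)) l ->
  l = (zeta z1 * (zeta z3)^-1) ^ (3 * k) *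
      qpow tau (- (3%:R / 2%:R) * ((complex.Im z1 - complex.Im z3) / v) ^+ 2) *
      f3 (z1 + z2 - z3) (z2 - z3) tau.
Proof.
move=> v v0 h0 h1 h2 Hl; set pref := _ * qpow _ _.
have p0 : pref != 0.
  by rewrite mulf_neq0 ?qpow_neq0 // expfz_neq0 // mulf_neq0 ?invr_eq0 ?e2pi_neq0.
(* Chosen so that the arguments of [chi3] are [s2] and [s2 - s3]. With [n1 = m1 - m2],
   [n2 = m1 + k], [n3 = m1 + k - m2] the exponent [3 n1 n2 - 3/2 n3^2] becomes
   [3/2 (m1^2 - m2^2) - 3/2 k^2]. *)
have bij : bijective (fun m : int * int => (m.1 + k, m.1 + k - m.2)).
  exists (fun n : int * int => (n.1 - k, n.1 - n.2)) => -[m1 m2] /=;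
  congr (_, _); ring.
have H := has_csumZ pref^-1 (has_csum_reindex bij Hl).
suff -> : f3 (z1 + z2 - z3) (z2 - z3) tau = pref^-1 * l by rewrite mulrA mulfV // mul1r.
apply: has_csum_csum; apply: has_csum_eq H => -[m1 m2] /=.
rewrite -/(g4_term z1 z2 z3 tau (m1 + k - m2 - k, m1 + k, m1 + k - m2)).
have ImD (x y : C) : complex.Im (x + y) = complex.Im x + complex.Im y by case: x; case: y.
have ImN (x : C) : complex.Im (- x) = - complex.Im x by case: x.
rewrite !ImD !ImN -/v.
set s2 := Defs.shift v _ (m1 + k); set s3 := Defs.shift v _ (m1 + k - m2).
have x1E : Defs.shift v (complex.Im z1 + complex.Im z2 - complex.Im z3) m1 = s2.
  rewrite /s2 /Defs.shift (_ : _ - complex.Im z3 = k%:~R * v + complex.Im z2); last first.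
    by rewrite -h0; ring.
  by rewrite mulrDl mulfK ?gt_eqF // intrD; ring.
have x2E : Defs.shift v (complex.Im z2 - complex.Im z3) m2 = s2 - s3.
  by rewrite /s2 /s3 /Defs.shift mulrBl intrB; ring.
have [d d0 D] := inZv_gap v0 h1; have [e e0 E] := inZv_gap v0 h2.
have s30 : s3 != 0 by rewrite -normr_gt0 (lt_le_trans d0 (D _)).
have s230 : s2 - s3 != 0 by rewrite -x2E -normr_gt0 (lt_le_trans e0 (E _)).
rewrite x1E x2E chi3E //; last by rewrite opprB addrC subrK.
rewrite subKr subr_ge0 subr_lt0.
have -> : ((((s3 <= s2) && (0 <= s3))%:R - ((s2 < s3) && (s3 < 0))%:R : R)%:C : C) =
   ((s3 <= s2) && (0 <= s3))%:R - ((s2 < s3) && (s3 < 0))%:R.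
  by rewrite rmorphB !rmorph_nat.
have gen (p X t q x y : C) : p != 0 -> t = p * (q * x * y) -> p^-1 * (X * t) = X * q * x * y.
  by move=> pn ->; field.
apply: gen => //; rewrite /pref.
rewrite h0 mulfK ?gt_eqF // g4_termE /qpow /zeta -!e2piZ.
have -> : (e2pi z1 / e2pi z3) ^ (3 * k) = e2pi ((3 * k)%:~R * (z1 - z3)).
  by rewrite e2piZ e2piB.
rewrite -!e2piD; congr e2pi.
rewrite !(rmorphB, rmorphN, rmorphM, rmorphXn, fmorphV, rmorph_int, rmorph_nat) /=.
by rewrite !intrD; field.
Qed.
End Evaluation.

Section ThetaSide.
Variable R : realType.
Local Notation C := R[i].

Lemma g4_term_slice (tau z1 z2 z3 : C) (k n1 n2 : int) :
  g4_term z1 z2 z3 tau (n1, n2, - k) =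
  (qpow tau (- (3%:R / 2%:R) * k%:~R ^+ 2) * zeta z3 ^ (3 * k)) *
  ((zeta z2 ^+ 3) ^ n1 * (zeta z1 ^+ 3 * qpow tau 3%:R ^ n1) ^ n2).
Proof.
rewrite g4_termE /zeta /qpow -!e2piX -!e2piZ -!e2piD -e2piZ -!e2piD; congr e2pi.
rewrite !(rmorphN, rmorphM, rmorphXn, fmorphV, rmorph_int, rmorph_nat) /=.
by field.
Qed.

Lemma theta_slice (tau z1 z2 z3 : C) (k : int) (l : C) : let v := complex.Im tau in
  0 < v -> complex.Im z3 = k%:~R * v ->
  ~ inZv v (complex.Im z1 - complex.Im z3) -> ~ inZv v (complex.Im z2 - complex.Im z3) ->
  has_csum (fun n : int * int =>
      (((0 <= Defs.shift v (complex.Im z1) n.1) && (0 <= Defs.shift v (complex.Im z2) n.2))%:R -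
       ((Defs.shift v (complex.Im z1) n.1 < 0) && (Defs.shift v (complex.Im z2) n.2 < 0))%:R) *
      g4_term z1 z2 z3 tau (n.1, n.2, - k)) l ->
  l = - 'i%C * qpow tau (- (3%:R / 2%:R) * (complex.Im z3 / v) ^+ 2) * zeta z3 ^ (3 * k) *
    (eta (3%:R * tau) ^+ 3 * theta (3%:R * (z1 + z2)) (3%:R * tau) /
     (theta (3%:R * z1) (3%:R * tau) * theta (3%:R * z2) (3%:R * tau))).
Proof.
move=> v v0 hk h1 h2 Hl.
have Q1 : normc (qpow tau 3%:R) < 1 by apply: normc_qpow_lt1.
have [P [_ HP _]] := qpoch_cvg (qpow_neq0 tau 3%:R) Q1.
have ny (x : R) : ~ inZv v (x - complex.Im z3) -> ~ inZv v x.
  by move=> nx [m xE]; apply: nx; exists (m - k); rewrite xE hk intrB; ring.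
have n1 := ny _ h1; have n2 := ny _ h2.
rewrite hk mulfK ?gt_eqF //.
set w1 := qpow tau _; set w2 := zeta z3 ^ _.
have w0 : w1 * w2 != 0 by rewrite mulf_neq0 ?qpow_neq0 // expfz_neq0 // e2pi_neq0.
have := theta_quotient v0 HP (regular_zeta3 v0 n1) (regular_zeta3 v0 n2).
have H : has_csum (fun n : int * int =>
      (((0 <= Defs.shift v (complex.Im z1) n.1) && (0 <= Defs.shift v (complex.Im z2) n.2))%:R -
       ((Defs.shift v (complex.Im z1) n.1 < 0) && (Defs.shift v (complex.Im z2) n.2 < 0))%:R) *
      ((zeta z2 ^+ 3) ^ n.1 * (zeta z1 ^+ 3 * qpow tau 3%:R ^ n.1) ^ n.2)) ((w1 * w2)^-1 * l).
  apply: has_csum_eq (has_csumZ _ Hl) => -[m1 m2]; rewrite g4_term_slice.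
  have gen (w X t : C) : w != 0 -> w^-1 * (X * (w * t)) = X * t by move=> wn; field.
  exact: gen.
rewrite -(kron_lattice v0 n1 n2 HP H).
move: (_ / _ : C) => q qE.
have -> : - 'i%C * w1 * w2 * q = w1 * w2 * (- 'i%C * q) by ring.
by rewrite qE mulrA mulfV // mul1r.
Qed.
End ThetaSide.

(* In each part [k] is the integer [y_3 / v], resp. [(y_1 - y_3) / v],
   [(y_2 - y_3) / v]. *)
Theorem proposition7p5 (R : realType) (tau z1 z2 z3 : R[i])
    (htau : 0 < complex.Im tau) :
  let v := complex.Im tau in
  let y1 := complex.Im z1 in
  let y2 := complex.Im z2 in
  let y3 := complex.Im z3 in
  [/\ forall k : int, y3 = k%:~R * v ->
        ~ inZv v (y1 - y3) -> ~ inZv v (y2 - y3) ->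
        (g4 z1 z2 (z3 + 'i%C * eps%:C) tau - g4 z1 z2 (z3 - 'i%C * eps%:C) tau
           : (R[i])^o) @[eps --> (0 : R)^'+] -->
        (- 'i%C * qpow tau (- (3%:R / 2%:R) * (y3 / v) ^+ 2) *
         zeta z3 ^ (3 * k) *
         (eta (3%:R * tau) ^+ 3 * theta (3%:R * (z1 + z2)) (3%:R * tau) /
          (theta (3%:R * z1) (3%:R * tau) * theta (3%:R * z2) (3%:R * tau)))
           : (R[i])^o),
      forall k : int, y1 - y3 = k%:~R * v ->
        ~ inZv v y3 -> ~ inZv v (y2 - y3) ->
        (g4 (z1 + 'i%C * eps%:C) z2 z3 tau - g4 (z1 - 'i%C * eps%:C) z2 z3 tau
           : (R[i])^o) @[eps --> (0 : R)^'+] -->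
        ((zeta z1 * (zeta z3)^-1) ^ (3 * k) *
         qpow tau (- (3%:R / 2%:R) * ((y1 - y3) / v) ^+ 2) *
         f3 (z1 + z2 - z3) (z2 - z3) tau : (R[i])^o)
    & forall k : int, y2 - y3 = k%:~R * v ->
        ~ inZv v y3 -> ~ inZv v (y1 - y3) ->
        (g4 z1 (z2 + 'i%C * eps%:C) z3 tau - g4 z1 (z2 - 'i%C * eps%:C) z3 tau
           : (R[i])^o) @[eps --> (0 : R)^'+] -->
        ((zeta z2 * (zeta z3)^-1) ^ (3 * k) *
         qpow tau (- (3%:R / 2%:R) * ((y2 - y3) / v) ^+ 2) *
         f3 (z1 + z2 - z3) (z1 - z3) tau : (R[i])^o)].
Proof.
move=> v y1 y2 y3; split=> k hk h1 h2; apply/tends_cvg.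
- have [L HT HL] := g4_jump3 htau hk h1 h2.
  by rewrite -(theta_slice htau hk h1 h2 HL).
- have [L HT HL] := g4_jump1 htau hk h1 h2.
  by rewrite -(f3_slice htau hk h1 h2 HL).
(* Part (2) with [z1] and [z2] exchanged. *)
have [L HT HL] := g4_jump1 htau hk h1 h2.
rewrite [z1 + z2]addrC -(f3_slice htau hk h1 h2 HL).
by apply: tends_eq HT; apply: nearW => e; rewrite !(g4_swap _ z1).
Qed.
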